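(* Let $\beta\in[0,1)$ and let $U:\mathbb{R}^d\to\mathbb{R}$ satisfy: (i) $U$ is twice continuously differentiable, $\nabla U(0)=0$, and $\sup_x\|\mathrm{D}^2U(x)\|\le\mathtt{L}$ for some $\mathtt{L}\ge0$; (ii) there exist $\mathtt{m}_\beta>0$ and $\mathtt{L}_\beta,\mathtt{K}_\beta\ge0$ such that for all $x,y\in\mathbb{R}^d$ with $\|x\|\ge\mathtt{K}_\beta$ and $\|y\|=1$, $$\frac{\mathtt{L}_\beta}{1+\|x\|^{3\beta/4}}\ge \mathrm{D}^2U(x)[y,y]\ge\frac{\mathtt{m}_\beta}{1+\|x\|^\beta}.$$ Let $\bar\eta_\beta=\mathtt{m}_\beta/2^5$ and $W_{\bar\eta_\beta}(x)=\exp\{\bar\eta_\beta(1+\|x\|^2)^{1/2}\}$. Then there exists $\Gamma_\beta>0$ such that for every $\gamma\in(0,\Gamma_\beta]$ there exist $C_{\gamma,\beta}\ge0$ and $\rho_{\gamma,\beta}\in[0,1)$ such that for all $x\in\mathbb{R}^d$ and $k\in\mathbb{N}$, $$\|\delta_xR_\gamma^k-\pi\|_{W_{\bar\eta_\beta}}\le C_{\gamma,\beta}\rho_{\gamma,\beta}^kW_{\bar\eta_\beta}(x).$$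
   Context: $\pi$ denotes the probability density proportional to $e^{-U}$ and the associated measure. For $\gamma>0$, $r_\gamma(x,y)=(4\pi\gamma)^{-d/2}\exp(-\|y-x+\gamma\nabla U(x)\|^2/(4\gamma))$, $\alpha_\gamma(x,y)=1\wedge\frac{\pi(y)r_\gamma(y,x)}{\pi(x)r_\gamma(x,y)}$, and the MALA kernel is $R_\gamma(x,A)=\int\mathbb{1}_A(y)\alpha_\gamma(x,y)r_\gamma(x,y)dy+\delta_x(A)\int\{1-\alpha_\gamma(x,y)\}r_\gamma(x,y)dy$. For $V\ge1$ measurable and a finite signed measure $\mu$, $\|\mu\|_V=\sup\{|\int fd\mu|:\sup_x|f(x)|/V(x)\le1\}$. *)

(* Defs.v *)
From HB Require Import structures.
From mathcomp Require Import all_boot all_order all_algebra.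
From mathcomp Require Import all_classical all_reals all_analysis.
Set Implicit Arguments. Unset Strict Implicit. Unset Printing Implicit Defensive.
Import Order.TTheory GRing.Theory Num.Theory.
Import numFieldNormedType.Exports.
Local Open Scope classical_set_scope.
Local Open Scope ring_scope.

(* R^d is represented by d.-tuple R, which carries the library's product
   sigma-algebra (= Borel sigma-algebra of R^d). *)
Section Rd.
Variable R : realType.
Variable d : nat.
Notation Rd := (d.-tuple R).

Definition vadd (x y : Rd) : Rd := [tuple tnth x i + tnth y i | i < d].
Definition vopp (x : Rd) : Rd := [tuple - tnth x i | i < d].
Definition vscale (a : R) (x : Rd) : Rd := [tuple a * tnth x i | i < d].
Definition origin : Rd := [tuple (0 : R) | i < d].
Definition ebasis (i : 'I_d) : Rd := [tuple (i == j)%:R | j < d].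
Definition vnorm (x : Rd) : R := Num.sqrt (\sum_(i < d) tnth x i ^+ 2).

Definition partial (f : Rd -> R) (i : 'I_d) (x : Rd) : R :=
  derive1 (fun t : R => f (vadd x (vscale t (ebasis i)))) 0.
Definition has_partial (f : Rd -> R) (i : 'I_d) (x : Rd) : Prop :=
  derivable (fun t : R => f (vadd x (vscale t (ebasis i)))) 0 1.

Definition vcontinuous (g : Rd -> R) : Prop :=
  forall x (e : R), 0 < e -> exists2 del : R, 0 < del &
    forall y, vnorm (vadd y (vopp x)) < del -> `|g y - g x| < e.

Definition C2 (U : Rd -> R) : Prop :=
  [/\ forall i x, has_partial U i x,
      forall i j x, has_partial (partial U i) j x &
      forall i j, vcontinuous (partial (partial U i) j)].

Definition grad (U : Rd -> R) (x : Rd) : Rd := [tuple partial U i x | i < d].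
Definition hess (U : Rd -> R) (x y z : Rd) : R :=
  \sum_(i < d) \sum_(j < d) tnth y i * tnth z j * partial (partial U i) j x.

(* Lebesgue integral over R^d, as iterated integral (Tonelli) of
   nonnegative extended functions *)
Fixpoint tint (n : nat) : (n.-tuple R -> \bar R) -> \bar R :=
  match n return (n.-tuple R -> \bar R) -> \bar R with
  | 0 => fun f => f [tuple]
  | n'.+1 => fun f =>
      (\int[@lebesgue_measure R]_(t in setT)
         tint (fun s : n'.-tuple R => f [tuple of t :: s]))%E
  end.

Definition Rint (f : Rd -> R) : R :=
  fine (tint (fun x => (Num.max (f x) 0)%:E)) -
  fine (tint (fun x => (Num.max (- f x) 0)%:E)).

Definition pidens (U : Rd -> R) (x : Rd) : R :=
  expR (- U x) / Rint (fun y => expR (- U y)).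
Definition pi_int (U : Rd -> R) (f : Rd -> R) : R :=
  Rint (fun y => f y * pidens U y).

Definition rprop (U : Rd -> R) (gam : R) (x y : Rd) : R :=
  (4 * pi * gam) `^ (- (d%:R / 2)) *
  expR (- (vnorm (vadd (vadd y (vopp x)) (vscale gam (grad U x))) ^+ 2)
        / (4 * gam)).
Definition accept (U : Rd -> R) (gam : R) (x y : Rd) : R :=
  Num.min 1 ((pidens U y * rprop U gam y x) / (pidens U x * rprop U gam x y)).

(* MALA kernel acting on functions: (R_gamma f)(x) = int f(y) R_gamma(x,dy) *)
Definition mala (U : Rd -> R) (gam : R) (f : Rd -> R) (x : Rd) : R :=
  Rint (fun y => f y * accept U gam x y * rprop U gam x y) +
  f x * Rint (fun y => (1 - accept U gam x y) * rprop U gam x y).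

(* ||mu||_V <= c, where mu is given through its action f |-> int f dmu *)
Definition VnormLe (V : Rd -> R) (mu : (Rd -> R) -> R) (c : R) : Prop :=
  forall f : Rd -> R, measurable_fun setT f ->
    (forall x, `|f x| <= V x) -> `|mu f| <= c.

Definition Wfun (eta : R) (x : Rd) : R := expR (eta * Num.sqrt (1 + vnorm x ^+ 2)).

End Rd.

(* Main.v *)
(** Harris' theorem is applied in its dual form, as a contraction for a weighted
    oscillation seminorm of functions; it needs a drift for W = exp(eta (1 + |x|^2)^(1/2)),
    a minorization on the sublevel sets of W, and invariance of pi, which follows
    from reversibility and Tonelli.

    For the drift, write a proposal as y = x - gam g + z with g = grad U x. As
    |x| goes to infinity with gam fixed, cocoercivity and <g, x> / |x| -> oo give
    |x - gam g| <= |x| - D for every D, so that the proposal part of the kernel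
    contributes o(W(x)). It remains to bound the acceptance probability from
    below. Its logarithm is the error of the trapezoidal rule for U along v = y - x
    plus (gam/4) (|grad U x|^2 - |grad U y|^2); with H_t the Hessian at x + t v this
    is the integral over [0, 1] of
      (t - 1/2) H_t v v - (gam/2) H_t v g,
    up to - (gam/4) |grad U y - g|^2. On v = - gam g it equals t gam^2 H_t g g >= 0. The
    cross terms between g and z are absorbed by Cauchy-Schwarz for H_t, and what is
    lost near t = 0 and in the last term is dominated by the gain because the
    square of the upper bound on H is at most a constant times its lower bound
    (2 * 3 beta / 4 >= beta). *)
Require Import Defs.
From HB Require Import structures.
From mathcomp Require Import all_boot all_order all_algebra.
From mathcomp Require Import all_classical all_reals all_analysis.
From mathcomp Require Import measurable_realfun ring lra.
Set Implicit Arguments. Unset Strict Implicit. Unset Printing Implicit Defensive.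
Import Order.TTheory GRing.Theory Num.Theory.
Import numFieldNormedType.Exports.
Local Open Scope classical_set_scope.
Local Open Scope ring_scope.

(** * Vectors *)

(** Integrals over [0, 1] along a segment are never formed: an estimate of the derivative at the one
    point given by [MVT01] replaces them, if needed after subtracting an antiderivative of the
    claimed bound. The order of choices shapes the drift. The step gam is fixed first, by conditions
    involving only L, Lb and mb. Noise with |z| <= d then suffices for a lower bound a on the
    accepted mass far out, since a cube of proposals has positive Gaussian mass. Only afterwards is
    D chosen, from a, eta and the exponential moment of the noise; contraction by every D is what
    permits this. [Rint] is total and in general linear only on integrable data. Harris' theorem is
    therefore stated for functionals on a class of functions, later the measurable functions bounded
    by a multiple of W, and iterated integrals are turned into integrals for one measure on tuples,
    where Tonelli and domination apply. *)

Section vectors.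
Variables (R : realType) (d : nat).
Notation Rd := (d.-tuple R).
Implicit Types (x y z v w : Rd) (a b t : R).

Lemma tnth_vadd x y i : tnth (vadd x y) i = tnth x i + tnth y i.
Proof. by rewrite tnth_mktuple. Qed.
Lemma tnth_vopp x i : tnth (vopp x) i = - tnth x i.
Proof. by rewrite tnth_mktuple. Qed.
Lemma tnth_vscale a x i : tnth (vscale a x) i = a * tnth x i.
Proof. by rewrite tnth_mktuple. Qed.
Lemma tnth_origin i : tnth (origin R d) i = 0.
Proof. by rewrite tnth_mktuple. Qed.
Lemma tnth_ebasis i j : tnth (ebasis R i : Rd) j = (i == j)%:R.
Proof. by rewrite tnth_mktuple. Qed.
Lemma tnth_grad (U : Rd -> R) x i : tnth (grad U x) i = partial U i x.
Proof. by rewrite tnth_mktuple. Qed.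
Definition tnthE := (tnth_vadd, tnth_vopp, tnth_vscale, tnth_origin,
  tnth_ebasis, tnth_grad).

Definition dot x y : R := \sum_(i < d) tnth x i * tnth y i.

Lemma dotC x y : dot x y = dot y x.
Proof. by apply: eq_bigr => i _; rewrite mulrC. Qed.

Lemma dotDl x y z : dot (vadd x y) z = dot x z + dot y z.
Proof. by rewrite /dot -big_split; apply: eq_bigr => i _; rewrite tnthE mulrDl. Qed.

Lemma dotZl a x y : dot (vscale a x) y = a * dot x y.
Proof. by rewrite /dot mulr_sumr; apply: eq_bigr => i _; rewrite tnthE mulrA. Qed.

Lemma dotNl x y : dot (vopp x) y = - dot x y.
Proof. by rewrite /dot -sumrN; apply: eq_bigr => i _; rewrite tnthE mulNr. Qed.

Lemma dotDr x y z : dot x (vadd y z) = dot x y + dot x z.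
Proof. by rewrite dotC dotDl !(dotC _ x). Qed.

Lemma dotZr a x y : dot x (vscale a y) = a * dot x y.
Proof. by rewrite dotC dotZl dotC. Qed.

Lemma dotNr x y : dot x (vopp y) = - dot x y.
Proof. by rewrite dotC dotNl dotC. Qed.

Lemma dot_ge0 x : 0 <= dot x x.
Proof. by apply: sumr_ge0 => i _; rewrite -expr2 sqr_ge0. Qed.

Lemma vnorm_ge0 x : 0 <= vnorm x.
Proof. exact: sqrtr_ge0. Qed.

Lemma vnorm_sqr x : vnorm x ^+ 2 = dot x x.
Proof.
rewrite sqr_sqrtr; first by apply: eq_bigr => i _; rewrite expr2.
by apply: sumr_ge0 => i _; exact: sqr_ge0.
Qed.

(** Expanding the square of | |y| x - |x| y | gives the bound multiplied by |x| |y|; when this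
    product is 0, one of the vectors is. *)
Lemma dot_le x y : dot x y <= vnorm x * vnorm y.
Proof.
have [x0|x0] := ltP 0 (vnorm x * vnorm y).
  have := dot_ge0 (vadd (vscale (vnorm y) x) (vopp (vscale (vnorm x) y))).
  rewrite !(dotDl, dotDr, dotNl, dotNr, dotZl, dotZr) -!vnorm_sqr (dotC y x).
  by move=> H; rewrite -(ler_pM2l x0); nra.
have {x0} : vnorm x * vnorm y = 0.
  by apply/eqP; rewrite eq_le x0 mulr_ge0 ?vnorm_ge0.
have dot0 u v : vnorm u = 0 -> dot u v = 0.
  move=> u0; apply: big1 => i _.
  have : dot u u = 0 by rewrite -vnorm_sqr u0 expr0n.
  move/eqP; rewrite psumr_eq0; last by move=> j _; rewrite -expr2 sqr_ge0.
  by move/allP => /(_ i (mem_index_enum _)); rewrite -expr2 sqrf_eq0 => /eqP ->; rewrite mul0r.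
move=> /[dup] xy0 /eqP; rewrite mulf_eq0 xy0 => /orP[] /eqP h.
  by rewrite (dot0 x).
by rewrite dotC (dot0 y).
Qed.

Lemma normr_dot_le x y : `|dot x y| <= vnorm x * vnorm y.
Proof.
rewrite ler_norml dot_le andbT lerNl -dotNl.
apply: le_trans (dot_le _ _) _; rewrite le_eqVlt; apply/orP; left; apply/eqP.
congr (_ * _); congr Num.sqrt; apply: eq_bigr => i _; by rewrite tnthE sqrrN.
Qed.

Lemma vnorm_vopp x : vnorm (vopp x) = vnorm x.
Proof. by congr Num.sqrt; apply: eq_bigr => i _; rewrite tnthE sqrrN. Qed.

Lemma vnorm_vscale a x : vnorm (vscale a x) = `|a| * vnorm x.
Proof.
rewrite -sqrtr_sqr /vnorm -sqrtrM ?sqr_ge0// mulr_sumr; congr Num.sqrt.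
by apply: eq_bigr => i _; rewrite tnthE exprMn.
Qed.

Lemma vnorm_vadd x y : vnorm (vadd x y) <= vnorm x + vnorm y.
Proof.
rewrite -[leRHS]ger0_norm ?addr_ge0 ?vnorm_ge0// -sqrtr_sqr ler_wsqrtr//.
have -> : \sum_(i < d) tnth (vadd x y) i ^+ 2 = dot (vadd x y) (vadd x y).
  by apply: eq_bigr => i _; rewrite expr2.
rewrite !(dotDl, dotDr) (dotC y x) -!vnorm_sqr; have := dot_le x y; lra.
Qed.

Lemma normr_tnth_le x i : `|tnth x i| <= vnorm x.
Proof.
rewrite -sqrtr_sqr ler_wsqrtr// (bigD1 i)//= lerDl.
by apply: sumr_ge0 => j _; exact: sqr_ge0.
Qed.

Lemma vnorm_le_sum x : vnorm x <= \sum_(i < d) `|tnth x i|.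
Proof.
have s0 : 0 <= \sum_(i < d) `|tnth x i| by apply: sumr_ge0.
rewrite -[leRHS]ger0_norm// -sqrtr_sqr ler_wsqrtr//.
rewrite expr2 mulr_suml; apply: ler_sum => i _.
rewrite -real_normK ?num_real// expr2 ler_wpM2l// (bigD1 i)//= lerDl.
by apply: sumr_ge0.
Qed.

Lemma sum_le_vnorm x : \sum_(i < d) `|tnth x i| <= d%:R * vnorm x.
Proof.
apply: le_trans (ler_sum _ (fun i _ => normr_tnth_le x i)) _.
by rewrite sumr_const card_ord mulr_natl.
Qed.

Lemma vnorm_ebasis i : vnorm (ebasis R i : Rd) = 1.
Proof.
rewrite /vnorm (bigD1 i)//= tnthE eqxx expr1n big1 ?addr0 ?sqrtr1// => j ji.
by rewrite tnthE eq_sym (negbTE ji) expr0n.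
Qed.

Lemma line_shift x v a b :
  vadd (vadd x (vscale a v)) (vscale b v) = vadd x (vscale (a + b) v).
Proof. by apply: eq_from_tnth => i; rewrite !tnthE; ring. Qed.

Lemma line0 x v : vadd x (vscale 0 v) = x.
Proof. by apply: eq_from_tnth => i; rewrite !tnthE mul0r addr0. Qed.

Lemma line1 x v : vadd x (vscale 1 v) = vadd x v.
Proof. by apply: eq_from_tnth => i; rewrite !tnthE mul1r. Qed.

Lemma vadd_subK x y : vadd x (vadd y (vopp x)) = y.
Proof. by apply: eq_from_tnth => i; rewrite !tnthE addrC subrK. Qed.

Lemma line_end x y : vadd x (vscale 1 (vadd y (vopp x))) = y.
Proof. by apply: eq_from_tnth => i; rewrite !tnthE mul1r addrC subrK. Qed.

Lemma vaddK x v : vadd (vadd x v) (vopp x) = v.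
Proof. by apply: eq_from_tnth => i; rewrite !tnthE addrC addKr. Qed.

End vectors.

(** Every Taylor or integral argument along a segment below is reduced to this form, with the
    segment parametrized by [0, 1]. *)
Lemma MVT01 (R : realType) (f df : R -> R) :
  (forall t : R, is_derive t 1 f (df t)) ->
  exists2 c, 0 <= c <= 1 & f 1 - f 0 = df c.
Proof.
move=> fd.
have [|c c01 ->] := @MVT_segment _ f df 0 1 ler01 (fun x _ => fd x).
  apply: continuous_subspaceT => x; apply: differentiable_continuous.
  by apply/derivable1_diffP; apply: ex_derive.
by exists c; rewrite ?subr0 ?mulr1//; move: c01; rewrite in_itv.
Qed.

(** * Derivatives along coordinate lines *)

Section calculus.
Variables (R : realType) (d : nat).
Notation Rd := (d.-tuple R).
Implicit Types (f : Rd -> R) (x y v w : Rd) (s t : R).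

(** [has_partial] speaks of derivatives at parameter 0 only; moving the base point along the line
    gives them at every parameter. *)
Lemma is_derive_line f v x (D : R -> R) :
  (forall t, is_derive (0 : R) 1 (fun s => f (vadd (vadd x (vscale t v)) (vscale s v))) (D t)) ->
  forall t : R, is_derive t 1 (fun s => f (vadd x (vscale s v))) (D t).
Proof.
move=> H t; have [dg Dg] := H t.
have E h : h^-1 *: (f (vadd (vadd x (vscale t v)) (vscale (h *: 1 + 0) v)) -
    f (vadd (vadd x (vscale t v)) (vscale 0 v))) =
  h^-1 *: (f (vadd x (vscale (h *: 1 + t) v)) - f (vadd x (vscale t v))).
  by rewrite !line_shift !addr0 [t + _]addrC.
apply: DeriveDef.
  by move: dg; rewrite /derivable; under eq_fun do rewrite E.
by move: Dg; rewrite /derive; under eq_fun do rewrite E.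
Qed.

Lemma is_derive_coord f i x t : (forall x, has_partial f i x) ->
  is_derive t 1 (fun s => f (vadd x (vscale s (ebasis R i))))
    (partial f i (vadd x (vscale t (ebasis R i)))).
Proof.
move=> pf; move: t; apply: is_derive_line => t.
by apply: DeriveDef; [exact: pf|rewrite /partial derive1E].
Qed.

(** Scaling the parameter by s covers both signs of s with one interval [0, 1]. *)
Lemma MVT_coord f i x s : (forall x, has_partial f i x) ->
  exists2 c, 0 <= c <= 1 & f (vadd x (vscale s (ebasis R i))) - f x =
     s * partial f i (vadd x (vscale (c * s) (ebasis R i))).
Proof.
move=> pf.
pose g := fun t => f (vadd x (vscale t (ebasis R i))).
have dg (t : R) : is_derive t 1 (fun t => g (t * s)) (s * partial f i (vadd x (vscale (t * s) (ebasis R i)))).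
  have h1 := is_derive_coord x (t * s) pf.
  have h2 : is_derive t 1 (fun t : R => t * s) s.
    have : is_derive t 1 ((id : R -> R) * cst s) s.
      by apply: is_derive_eq; rewrite scaler0 add0r; exact: mulr1.
    by [].
  have := @is_derive1_comp _ g (fun t : R => t * s) _ _ _ h1 h2.
  by rewrite mulrC.
have [c c01 H] := MVT01 dg.
exists c => //; rewrite -H /g mul1r mul0r line0//.
Qed.

End calculus.

(** * Differential calculus along lines *)

Section C1.
Variables (R : realType) (d : nat).
Notation Rd := (d.-tuple R).
Implicit Types (f : Rd -> R) (x y v w : Rd) (s t : R).

Definition take_coords (k : nat) w : Rd := [tuple if (i < k)%N then tnth w i else 0 | i < d].

Lemma tnth_take_coords k w i : tnth (take_coords k w) i = if (i < k)%N then tnth w i else 0.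
Proof. by rewrite tnth_mktuple. Qed.

Lemma sum_ltnS (G : 'I_d -> R) k (kd : (k < d)%N) :
  \sum_(i < d | (i < k.+1)%N) G i = G (Ordinal kd) + \sum_(i < d | (i < k)%N) G i.
Proof.
rewrite (bigD1 (Ordinal kd))//=; congr (_ + _); apply: eq_bigl => i.
by rewrite ltnS -val_eqE/= andbC [RHS]ltn_neqAle.
Qed.

(* Move from x to x + w one coordinate at a time. *)
Lemma increment_le f x w (a : 'I_d -> R) e :
  (forall i z, has_partial f i z) ->
  (forall i z, (forall j, `|tnth z j - tnth x j| <= `|tnth w j|) ->
    `|partial f i z - a i| <= e) ->
  `|f (vadd x w) - f x - \sum_(i < d) tnth w i * a i| <= e * \sum_(i < d) `|tnth w i|.
Proof.
move=> pf ha.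
suff H k : (k <= d)%N -> `|f (vadd x (take_coords k w)) - f x - \sum_(i < d | (i < k)%N) tnth w i * a i| <=
   e * \sum_(i < d | (i < k)%N) `|tnth w i|.
  have := H d (leqnn d).
  have -> : take_coords d w = w by apply: eq_from_tnth => i; rewrite tnth_take_coords ltn_ord.
  congr (`|_ - _| <= _ * _); apply: eq_bigl => i; exact: ltn_ord.
elim: k => [_|k IH kd].
  have -> : vadd x (take_coords 0 w) = x by apply: eq_from_tnth => i; rewrite tnth_vadd tnth_take_coords addr0.
  by rewrite !big_pred0// !subrr normr0 mulr0.
pose i0 := Ordinal kd.
have -> : vadd x (take_coords k.+1 w) = vadd (vadd x (take_coords k w)) (vscale (tnth w i0) (ebasis R i0)).
  apply: eq_from_tnth => i; rewrite !tnthE !tnth_take_coords ltnS leq_eqVlt.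
  have [->|ik] := eqVneq i i0.
    by rewrite eqxx /= ltnn mulr1 addr0.
  by rewrite -val_eqE /= in ik; rewrite (negbTE ik) mulr0 addr0.
have [c /andP[c0 c1] hc] := MVT_coord (vadd x (take_coords k w)) (tnth w i0) (pf i0).
rewrite !(sum_ltnS _ kd) -/i0.
set z := vadd _ (vscale (c * _) _) in hc.
have zx : `|partial f i0 z - a i0| <= e.
  apply: ha => j; rewrite !tnthE !tnth_take_coords.
  have [<-|ji] := eqVneq i0 j.
    rewrite /= ltnn addr0 addrAC subrr add0r mulr1 normrM ger0_norm//.
    by rewrite -[leRHS]mul1r ler_wpM2r.
  rewrite mulr0 addr0 addrAC subrr add0r; case: ifP => // _; by rewrite normr0.
set u := vadd (vadd x (take_coords k w)) _ in hc *.
have -> : f u - f x - (tnth w i0 * a i0 + \sum_(i < d | (i < k)%N) tnth w i * a i) =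
   tnth w i0 * (partial f i0 z - a i0) +
   (f (vadd x (take_coords k w)) - f x - \sum_(i < d | (i < k)%N) tnth w i * a i).
  by rewrite mulrBr -hc; ring.
apply: le_trans (ler_normD _ _) _; rewrite [leRHS]mulrDr; apply: lerD; last exact/IH/ltnW.
by rewrite normrM mulrC ler_wpM2r.
Qed.

Lemma bounded_partial_lipschitz f M x y : (forall i z, has_partial f i z) ->
  (forall i z, `|partial f i z| <= M) ->
  `|f y - f x| <= M * \sum_(i < d) `|tnth y i - tnth x i|.
Proof.
move=> pf fM.
have := @increment_le f x (vadd y (vopp x)) (fun=> 0) M pf.
rewrite vadd_subK big1 ?subr0; last by move=> i _; rewrite mulr0.
move=> /(_ _)/le_trans; apply; first by move=> i z _; rewrite subr0.
by under eq_bigr do rewrite !tnthE.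
Qed.

Lemma lipschitz_vcontinuous f M :
  (forall x y, `|f y - f x| <= M * \sum_(i < d) `|tnth y i - tnth x i|) ->
  vcontinuous f.
Proof.
move=> fM x e e0.
pose N := `|M| * d%:R + 1.
have N0 : 0 < N by rewrite ltr_wpDl// mulr_ge0.
exists (e / N); first by rewrite divr_gt0.
move=> y; rewrite ltr_pdivlMr// => yx; apply: le_lt_trans (fM _ _) _.
apply: le_lt_trans yx.
have -> : \sum_(i < d) `|tnth y i - tnth x i| = \sum_(i < d) `|tnth (vadd y (vopp x)) i|.
  by apply: eq_bigr => i _; rewrite !tnthE.
have := sum_le_vnorm (vadd y (vopp x)).
have := ler_norm M; have := vnorm_ge0 (vadd y (vopp x)).
set S := \sum_(i < d) _; set n := vnorm _ => n0 MM Sn.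
have S0 : 0 <= S by apply: sumr_ge0.
apply: (@le_trans _ _ (`|M| * (d%:R * n))); last by rewrite /N; lra.
apply: (@le_trans _ _ (`|M| * S)); first by rewrite ler_wpM2r.
by rewrite ler_wpM2l.
Qed.

(** Chain rule from continuous partials: [increment_le], with a the partials at the base point,
    bounds the remainder by a small multiple of |h|. *)
Lemma is_derive_C1 f v x t : (forall i z, has_partial f i z) ->
  (forall i, vcontinuous (partial f i)) ->
  is_derive t 1 (fun s => f (vadd x (vscale s v)))
    (\sum_(i < d) tnth v i * partial f i (vadd x (vscale t v))).
Proof.
move=> pf cf; move: t; apply: (@is_derive_line _ _ f v x
  (fun t => \sum_(i < d) tnth v i * partial f i (vadd x (vscale t v)))) => t.
set y := vadd x (vscale t v); set D := \sum_(i < d) _.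
pose S := \sum_(i < d) `|tnth v i|.
have S0 : 0 <= S by apply: sumr_ge0.
suff cvgD : (fun h : R => h^-1 *: (f (vadd y (vscale (h *: 1 + 0) v)) - f (vadd y (vscale 0 v)))) @ 0^' --> D.
  apply: DeriveDef; first by apply/cvg_ex; exists D; exact: cvgD.
  exact/cvg_lim.
apply/cvgrPdist_le => e e0.
(* S vanishes when v = 0, hence S + 1 as the divisor. *)
pose e' := e / (S + 1).
have S1 : 0 < S + 1 by lra.
have e'0 : 0 < e' by rewrite divr_gt0.
have [del del0 hdel] : exists2 del : R, 0 < del & forall i z, vnorm (vadd z (vopp y)) < del ->
    `|partial f i z - partial f i y| <= e'.
  have /choice[g hg] : forall i, exists del : R, 0 < del /\ forall z, vnorm (vadd z (vopp y)) < del ->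
    `|partial f i z - partial f i y| <= e'.
    move=> i; have [del del0 h] := cf i y _ e'0.
    by exists del; split=> // z /h /ltW.
  exists (\big[Num.min/1]_(i < d) g i).
    by apply: lt_bigmin => // i _; have [] := hg i.
  move=> i z hz; apply: (hg i).2; apply: lt_le_trans hz _; exact: bigmin_le.
have d0 : 0 < del / (S + 1) by rewrite divr_gt0.
have hn : \forall h \near (0 : R)^', h != 0 /\ `|h| < del / (S + 1).
  near=> h; split; first by near: h; exact: nbhs_dnbhs_neq.
  near: h; apply: dnbhs0_lt => //.
near=> h; have [h0 hdl] : h != 0 /\ `|h| < del / (S + 1) by near: h.
rewrite line0 addr0 (_ : h *: 1 = h); last exact: mulr1.
have := @increment_le f y (vscale h v) (fun i => partial f i y) e' pf.
have -> : \sum_(i < d) tnth (vscale h v) i * partial f i y = h * D.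
  by rewrite /D mulr_sumr; apply: eq_bigr => i _; rewrite tnthE mulrA.
have -> : \sum_(i < d) `|tnth (vscale h v) i| = `|h| * S.
  by rewrite /S mulr_sumr; apply: eq_bigr => i _; rewrite tnthE normrM.
move=> H.
have {}H : `|f (vadd y (vscale h v)) - f y - h * D| <= e' * (`|h| * S).
  apply: H => i z hz; apply: hdel.
  apply: le_lt_trans (vnorm_le_sum _) _.
  apply: (@le_lt_trans _ _ (`|h| * S)); last first.
    rewrite ltr_pdivlMr// in hdl; apply: le_lt_trans hdl; rewrite ler_wpM2l//; lra.
  rewrite /S mulr_sumr; apply: ler_sum => j _; have := hz j.
  by rewrite !tnthE normrM.
have -> : D - h^-1 *: (f (vadd y (vscale h v)) - f y) =
  - (h^-1 * (f (vadd y (vscale h v)) - f y - h * D)).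
  by rewrite /GRing.scale/=; field.
rewrite normrN normrM normfV mulrC ler_pdivrMr ?normr_gt0//.
apply: le_trans H _; rewrite mulrCA mulrC ler_wpM2r//.
rewrite /e' mulrAC ler_pdivrMr// ler_wpM2l ?(ltW e0)//; lra.
Unshelve. all: by end_near.
Qed.

Definition second_diff f i j x s : R :=
  f (vadd (vadd x (vscale s (ebasis R i))) (vscale s (ebasis R j)))
  - f (vadd x (vscale s (ebasis R i))) - f (vadd x (vscale s (ebasis R j))) + f x.

Lemma second_diffC f i j x s : second_diff f i j x s = second_diff f j i x s.
Proof.
rewrite /second_diff; congr (_ + _); rewrite addrAC; congr (f _ - _ - _).
by apply: eq_from_tnth => l; rewrite !tnthE -!addrA; congr (_ + _); exact: addrC.
Qed.

(** The mean value theorem is applied in direction i to the difference of f in direction j, then in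
    direction j to the partial in direction i. *)
Lemma second_partial_mean f i j x s : s != 0 ->
  (forall i z, has_partial f i z) -> (forall i j z, has_partial (partial f i) j z) ->
  exists2 z, vnorm (vadd z (vopp x)) <= 2 * `|s| &
    second_diff f i j x s = s ^+ 2 * partial (partial f i) j z.
Proof.
move=> s0 pf ppf.
pose g z := f (vadd z (vscale s (ebasis R j))) - f z.
have shift_swap z t k : vadd (vadd z (vscale t (ebasis R k))) (vscale s (ebasis R j)) =
    vadd (vadd z (vscale s (ebasis R j))) (vscale t (ebasis R k)).
  by apply: eq_from_tnth => l; rewrite !tnthE; ring.
have dg z (t : R) : is_derive t 1 (fun t => g (vadd z (vscale t (ebasis R i))))
   (partial f i (vadd (vadd z (vscale s (ebasis R j))) (vscale t (ebasis R i)))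
    - partial f i (vadd z (vscale t (ebasis R i)))).
  have h1 := is_derive_coord (vadd z (vscale s (ebasis R j))) t (pf i).
  have h2 := is_derive_coord z t (pf i).
  have := is_deriveB h1 h2.
  congr is_derive; apply/funext => r; rewrite /g /= shift_swap.
  by [].
have pg z : has_partial g i z by have [] := dg z 0.
have pgE z : partial g i z = partial f i (vadd z (vscale s (ebasis R j))) - partial f i z.
  by rewrite /partial derive1E; have [_ ->] := dg z 0; rewrite !line0.
have [c /andP[c0 c1] hc] := MVT_coord x s pg.
set z := vadd x (vscale (c * s) _) in hc.
have [c' /andP[c'0 c'1] hc'] := MVT_coord z s (ppf i j).
exists (vadd z (vscale (c' * s) (ebasis R j))).
  have -> : vadd (vadd z (vscale (c' * s) (ebasis R j))) (vopp x) =
     vadd (vscale (c * s) (ebasis R i)) (vscale (c' * s) (ebasis R j)).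
    by apply: eq_from_tnth => l; rewrite !tnthE; ring.
  apply: le_trans (vnorm_vadd _ _) _.
  rewrite !vnorm_vscale !vnorm_ebasis !mulr1 !normrM (ger0_norm c0) (ger0_norm c'0).
  have := normr_ge0 s; nra.
rewrite expr2 -mulrA -hc' -pgE -hc /g /second_diff; ring.
Qed.

Lemma dist_le_half (p q a b e : R) : p = q -> `|p - a| < e / 2 -> `|q - b| < e / 2 ->
  `|a - b| <= e.
Proof.
move=> <-; rewrite !ltr_norml ler_norml => /andP[? ?] /andP[? ?]; apply/andP; split; lra.
Qed.

(** [second_diff] is symmetric in i and j, so the two mixed partials agree at two points close to x;
    continuity at x finishes. *)
Lemma schwarz f i j x :
  (forall i z, has_partial f i z) -> (forall i j z, has_partial (partial f i) j z) ->
  (forall i j, vcontinuous (partial (partial f i) j)) ->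
  partial (partial f i) j x = partial (partial f j) i x.
Proof.
move=> pf ppf cppf; apply/eqP; rewrite -subr_eq0 -normr_le0.
apply/ler_addgt0Pr => e e0; rewrite add0r.
have e2 : 0 < e / 2 by lra.
have [d1 d10 h1] := cppf i j x _ e2.
have [d2 d20 h2] := cppf j i x _ e2.
(* Division by 3 puts both intermediate points, at distance at most 2 * s, inside both radii. *)
pose s := Num.min d1 d2 / 3.
have m0 : 0 < Num.min d1 d2 by rewrite lt_min d10.
have s0 : 0 < s by rewrite divr_gt0.
have sn0 : s != 0 by rewrite gt_eqF.
have s3 : 2 * `|s| < Num.min d1 d2.
  have : s * 3 = Num.min d1 d2 by rewrite divfK.
  by rewrite gtr0_norm//; lra.
move: s3; rewrite lt_min => /andP[s1 s2].
have [z1 hz1 E1] := second_partial_mean i j x sn0 pf ppf.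
have [z2 hz2 E2] := second_partial_mean j i x sn0 pf ppf.
have E : partial (partial f i) j z1 = partial (partial f j) i z2.
  apply: (@mulfI _ (s ^+ 2)); first by rewrite expf_neq0.
  exact: etrans (esym E1) (etrans (second_diffC _ _ _ _ _) E2).
apply: (dist_le_half E); [exact: h1 (le_lt_trans hz1 s1)|exact: h2 (le_lt_trans hz2 s2)].
Qed.

End C1.

(** * Gradient and Hessian *)

Section hessian.
Variables (R : realType) (d : nat) (U : d.-tuple R -> R) (L : R).
Notation Rd := (d.-tuple R).
Implicit Types (x y z v w : Rd) (s t : R).
Hypothesis UC2 : C2 U.
Hypothesis L_ge0 : 0 <= L.
Hypothesis grad0 : forall i, partial U i (origin R d) = 0.
Hypothesis hessL : forall x y z, `|hess U x y z| <= L * vnorm y * vnorm z.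

Lemma hessC x y z : hess U x y z = hess U x z y.
Proof.
have [pU ppU cppU] := UC2.
rewrite /hess exchange_big; apply: eq_bigr => i _; apply: eq_bigr => j _ /=.
by rewrite (schwarz j i x pU ppU cppU) [tnth y j * _]mulrC.
Qed.

Lemma hessDl x y z w : hess U x (vadd y z) w = hess U x y w + hess U x z w.
Proof.
rewrite /hess -big_split; apply: eq_bigr => i _; rewrite -big_split.
by apply: eq_bigr => j _ /=; rewrite tnth_vadd !mulrDl.
Qed.

Lemma hessZl x a y w : hess U x (vscale a y) w = a * hess U x y w.
Proof.
rewrite /hess mulr_sumr; apply: eq_bigr => i _; rewrite mulr_sumr.
by apply: eq_bigr => j _ /=; rewrite tnth_vscale !mulrA.
Qed.

Lemma hessDr x y z w : hess U x w (vadd y z) = hess U x w y + hess U x w z.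
Proof. by rewrite hessC hessDl !(hessC x w). Qed.

Lemma hessZr x a y w : hess U x w (vscale a y) = a * hess U x w y.
Proof. by rewrite hessC hessZl (hessC x w). Qed.

Lemma hess_ebasis x i j : hess U x (ebasis R i) (ebasis R j) = partial (partial U i) j x.
Proof.
rewrite /hess (bigD1 i)//= [X in _ + X]big1 ?addr0; last first.
  by move=> k ki; apply: big1 => l _; rewrite tnth_ebasis eq_sym (negbTE ki) !mul0r.
rewrite (bigD1 j)//= [X in _ + X]big1 ?addr0; last first.
  by move=> k kj; rewrite !tnth_ebasis eqxx [j == k]eq_sym (negbTE kj) mulr0 mul0r.
by rewrite !tnth_ebasis !eqxx !mul1r.
Qed.

Lemma partial2_le x i j : `|partial (partial U i) j x| <= L.
Proof.
by rewrite -hess_ebasis; have := hessL x (ebasis R i) (ebasis R j); rewrite !vnorm_ebasis !mulr1.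
Qed.

(** [C2] asks continuity of the second partials only; the first ones are Lipschitz because the
    Hessian is bounded. *)
Lemma vcontinuous_partial i : vcontinuous (partial U i).
Proof.
have [pU ppU cppU] := UC2.
apply: (@lipschitz_vcontinuous _ _ _ L) => x y.
exact: bounded_partial_lipschitz (ppU i) (fun j z => partial2_le z i j).
Qed.

Lemma is_derive_potential v x t :
  is_derive t 1 (fun s => U (vadd x (vscale s v))) (dot (grad U (vadd x (vscale t v))) v).
Proof.
have [pU ppU cppU] := UC2.
have := is_derive_C1 v x t pU vcontinuous_partial.
by congr is_derive; apply: eq_bigr => i _; rewrite tnth_grad mulrC.
Qed.

Lemma is_derive_grad v w x t :
  is_derive t 1 (fun s => dot (grad U (vadd x (vscale s v))) w) (hess U (vadd x (vscale t v)) w v).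
Proof.
have [pU ppU cppU] := UC2.
have H i : is_derive t 1 (tnth w i \*: (fun s => partial U i (vadd x (vscale s v))))
   (tnth w i *: \sum_(j < d) tnth v j * partial (partial U i) j (vadd x (vscale t v))).
  by apply: is_deriveZ; exact: is_derive_C1 (ppU i) (cppU i).
have := @is_derive_sum _ _ _ _ _ _ _ _ H.
congr is_derive.
  apply/funext => s; rewrite fct_sumE; apply: eq_bigr => i _.
  by rewrite tnth_grad mulrC.
apply: eq_bigr => i _; rewrite /GRing.scale/= mulr_sumr; apply: eq_bigr => j _.
by rewrite mulrA.
Qed.

(** The vector increment w of the gradient is tested against itself, which makes the scalar mean
    value theorem enough: |w|^2 is a value of the Hessian form at w, v, and one factor |w|
    cancels. *)
Lemma grad_lipschitz x y : vnorm (vadd (grad U y) (vopp (grad U x))) <= L * vnorm (vadd y (vopp x)).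
Proof.
set w := vadd (grad U y) _; set v := vadd y _.
have [c _] := MVT01 (is_derive_grad v w x).
rewrite line_end line0 => H.
have : vnorm w ^+ 2 <= L * vnorm w * vnorm v.
  apply: le_trans (hessL (vadd x (vscale c v)) w v).
  by apply: le_trans (ler_norm _); rewrite -H vnorm_sqr {1}/w dotDl dotNl.
have := vnorm_ge0 w; rewrite le_eqVlt => /predU1P[<-|w0].
  by rewrite mulr_ge0 ?vnorm_ge0.
by rewrite expr2 -mulrA mulrCA ler_pM2l.
Qed.

Lemma grad_origin : grad U (origin R d) = origin R d.
Proof. by apply: eq_from_tnth => i; rewrite tnth_grad grad0 tnth_origin. Qed.

Lemma vadd_vopp_origin x : vadd x (vopp (origin R d)) = x.
Proof. by apply: eq_from_tnth => i; rewrite tnth_vadd tnth_vopp tnth_origin subr0. Qed.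

Lemma grad_le x : vnorm (grad U x) <= L * vnorm x.
Proof. by have := grad_lipschitz (origin R d) x; rewrite grad_origin !vadd_vopp_origin. Qed.

Lemma potential_le x : `|U x - U (origin R d)| <= L * vnorm x ^+ 2.
Proof.
have [c /andP[c0 c1]] := MVT01 (is_derive_potential x (origin R d)).
have E t : vadd (origin R d) (vscale t x) = vscale t x.
  by apply: eq_from_tnth => i; rewrite tnth_vadd tnth_origin add0r.
rewrite line0 !E (_ : vscale 1 x = x); last first.
  by apply: eq_from_tnth => i; rewrite tnth_vscale mul1r.
move=> ->; apply: le_trans (normr_dot_le _ _) _.
rewrite expr2 mulrA ler_wpM2r ?vnorm_ge0//; apply: le_trans (grad_le _) _.
rewrite ler_wpM2l// vnorm_vscale ger0_norm// -[leRHS]mul1r.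
by rewrite ler_wpM2r ?vnorm_ge0.
Qed.

Lemma hess_quad mu nu x :
  (forall y, vnorm y = 1 -> hess U x y y <= nu /\ mu <= hess U x y y) ->
  forall y, hess U x y y <= nu * vnorm y ^+ 2 /\ mu * vnorm y ^+ 2 <= hess U x y y.
Proof.
move=> H y; have := vnorm_ge0 y; rewrite le_eqVlt => /predU1P[/esym y0|y0].
  rewrite y0 expr0n !mulr0.
  have : `|hess U x y y| <= 0 by apply: le_trans (hessL _ _ _) _; rewrite y0 !mulr0.
  by rewrite normr_le0 => /eqP ->.
pose u := vscale (vnorm y)^-1 y.
have yE : y = vscale (vnorm y) u.
  apply: eq_from_tnth => i; rewrite /u !tnth_vscale mulrA divff ?mul1r//.
  by rewrite gt_eqF.
have u1 : vnorm u = 1.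
  by rewrite vnorm_vscale ger0_norm ?invr_ge0 ?(ltW y0)// mulVf// gt_eqF.
have [h1 h2] := H u u1.
have -> : hess U x y y = hess U x u u * vnorm y ^+ 2.
  by rewrite {1 2}yE hessZl hessZr; ring.
by split; rewrite ler_wpM2r ?sqr_ge0.
Qed.

Lemma hess_comb x a b y z : hess U x (vadd (vscale a y) (vscale b z)) (vadd (vscale a y) (vscale b z)) =
  a ^+ 2 * hess U x y y + 2 * a * b * hess U x y z + b ^+ 2 * hess U x z z.
Proof. rewrite !(hessDl, hessDr, hessZl, hessZr) (hessC x z y); ring. Qed.

(** Nonnegativity of the form at s y + z and at s y - z. The free weight s is tuned at each use. *)
Lemma hess_AMGM x s y z : (forall w, 0 <= hess U x w w) ->
  `|2 * s * hess U x y z| <= s ^+ 2 * hess U x y y + hess U x z z.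
Proof.
move=> psd.
have := psd (vadd (vscale s y) (vscale 1 z)); have := psd (vadd (vscale s y) (vscale (-1) z)).
rewrite !hess_comb sqrrN expr1n !mul1r mulr1 => h1 h2.
rewrite ler_norml; apply/andP; split; lra.
Qed.

(** Unlike the global bound by L, this one carries the local constant M, which decays far from the
    origin. *)
Lemma hess_CS x M y z : (forall w, 0 <= hess U x w w <= M * vnorm w ^+ 2) ->
  `|hess U x y z| <= M * vnorm y * vnorm z.
Proof.
move=> H.
have psd w : 0 <= hess U x w w by have /andP[] := H w.
have M0 w : 0 <= M * vnorm w ^+ 2 by have /andP[] := H w; exact: le_trans.
have h0 w : vnorm w = 0 -> forall w', hess U x w w' = 0.
  move=> w0 w'; apply/eqP; rewrite -normr_le0.
  by apply: le_trans (hessL _ _ _) _; rewrite w0 mulr0 mul0r.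
have := vnorm_ge0 y; rewrite le_eqVlt => /predU1P[/esym y0|y0].
  by rewrite h0// normr0 y0 mulr0 mul0r.
have := vnorm_ge0 z; rewrite le_eqVlt => /predU1P[/esym z0|z0].
  by rewrite hessC h0// normr0 z0 mulr0.
(* This weight balances the two terms of [hess_AMGM]. *)
pose s := vnorm z / vnorm y.
have s0 : 0 < s by rewrite divr_gt0.
have sy : s * vnorm y = vnorm z by rewrite /s divfK// gt_eqF.
have := hess_AMGM s y z psd.
rewrite -mulrA normrM (ger0_norm (ler0n _ 2)) normrM (gtr0_norm s0).
have /andP[_ hy] := H y; have /andP[_ hz] := H z => h.
rewrite -(ler_pM2l s0).
have : s ^+ 2 * hess U x y y <= s ^+ 2 * (M * vnorm y ^+ 2) by rewrite ler_wpM2l ?sqr_ge0.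
have -> : s ^+ 2 * (M * vnorm y ^+ 2) = M * (s * vnorm y) ^+ 2 by ring.
have -> : s * (M * vnorm y * vnorm z) = M * (s * vnorm y) * vnorm z by ring.
rewrite sy; lra.
Qed.

End hessian.

(** * Acceptance ratio *)

Section log_acceptance.
Variables (R : realType) (d : nat) (U : d.-tuple R -> R) (L : R).
Notation Rd := (d.-tuple R).
Implicit Types (x y z v w : Rd) (s t : R).
Hypothesis UC2 : C2 U.
Hypothesis L_ge0 : 0 <= L.
Hypothesis hessL : forall x y z, `|hess U x y z| <= L * vnorm y * vnorm z.

(** The logarithm of the Metropolis ratio: |y - x|^2 occurs in both Gaussian exponents and cancels.
    See [accept_log]. *)
Definition log_ratio (gam : R) x y : R :=
  U x - U y + dot (vadd y (vopp x)) (vadd (grad U x) (grad U y)) / 2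
  - gam / 4 * (dot (grad U y) (grad U y) - dot (grad U x) (grad U x)).

(** Up to the last term this is F 1 - F 0 for F t = (t - 1/2) G_t v - U (x + t v) - (gam/2) G_t g,
    where G_t is the gradient at x + t v and g = G_0. In the derivative of F the first-order terms
    cancel, leaving the kernel t - 1/2 of the trapezoidal rule. *)
Lemma log_ratioE gam x v : log_ratio gam x (vadd x v) =
  (1 - 1 / 2) * dot (grad U (vadd x v)) v - U (vadd x v)
   - gam / 2 * dot (grad U (vadd x v)) (grad U x)
   - ((0 - 1 / 2) * dot (grad U x) v - U x - gam / 2 * dot (grad U x) (grad U x))
   - gam / 4 * vnorm (vadd (grad U (vadd x v)) (vopp (grad U x))) ^+ 2.
Proof.
rewrite /log_ratio vaddK vnorm_sqr.
move: (grad U x) (grad U (vadd x v)) => g g'.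
by rewrite !(dotDr, dotDl, dotNl, dotNr) (dotC v g) (dotC v g') (dotC g g'); field.
Qed.

(* The remainder [(1/2 - t) * H v v] of the trapezoidal rule is combined with
   the gradient term [gam/2 * H v g]: on the drift [v = - gam * g] they add up
   to [t * gam^2 * H g g >= 0]. The shift [t + tau] pays for the cross term
   near [t = 0]. *)
Lemma log_ratio_deriv (gam h c q t tau k : R) : 0 < gam -> 0 < tau -> 0 <= t ->
  t <= 1 -> 0 <= q -> q <= k * tau ->
  (forall s, `|2 * s * c| <= s ^+ 2 * h + q) ->
  t / 2 * gam ^+ 2 * h - tau / 2 * gam ^+ 2 * h - 9 / 8 * k - q / 2 <=
  (t - 1 / 2) * (gam ^+ 2 * h - 2 * gam * c + q) - gam / 2 * (- gam * h + c).
Proof.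
move=> gam0 tau0 t0 t1 q0 qk amgm.
have T0 : 0 < t + tau by lra.
have H : 3 / 2 * gam * `|c| <= (t + tau) / 2 * gam ^+ 2 * h + 9 / 8 * k.
  (* After multiplication by 9 / (8 (t + tau)) this weight produces the coefficients 3/2, 1/2 and
     9/8; q <= k tau <= k (t + tau) bounds the last term. *)
  have := amgm (2 / 3 * gam * (t + tau)).
  rewrite normrM ger0_norm; last by rewrite !mulr_ge0//; lra.
  move=> /(ler_wpM2l (ltW T0)) H.
  rewrite -(ler_pM2l (mulr_gt0 T0 T0)).
  have : (t + tau) * (q * (9 / 8)) <= (t + tau) * (k * (t + tau) * (9 / 8)).
    rewrite ler_pM2l// ler_pM2r; last by lra.
    have k0 : 0 <= k by rewrite -(pmulr_lge0 _ tau0); lra.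
    have := mulr_ge0 k0 t0; lra.
  move: H; set a := `|c|; nra.
(* The total coefficient of the cross term is 1/2 - 2 t, at most 3/2 in absolute value on [0, 1]. *)
have h2 : gam * c * (2 * t - 1 / 2) <= 3 / 2 * gam * `|c|.
  apply: le_trans (ler_norm _) _; rewrite 2!normrM gtr0_norm//.
  rewrite [leRHS](_ : _ = gam * `|c| * (3 / 2)); last by ring.
  rewrite ler_wpM2l ?mulr_ge0 ?(ltW gam0)// ler_norml; apply/andP; split; lra.
have h3 : 0 <= t * q by rewrite mulr_ge0.
lra.
Qed.

(** [log_ratio_deriv] with tau = k * M, integrated over [0, 1]: the mean 1/4 of t / 2 gives m / 4,
    and tau costs k M^2 / 2. The term (gam/4) |grad U y - g|^2 is bounded by (gam/4) M^2 |v|^2 with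
    |v|^2 <= 2 gam^2 |g|^2 + 2 |z|^2. *)
Lemma log_ratio_lower (gam : R) x z (m M k : R) : 0 < gam -> 0 <= m -> 0 < M -> 0 < k ->
  let v := vadd (vscale (- gam) (grad U x)) z in
  (forall t, 0 <= t <= 1 -> forall w, m * vnorm w ^+ 2 <= hess U (vadd x (vscale t v)) w w
     <= M * vnorm w ^+ 2) ->
  (m / 4 - k * M ^+ 2 / 2 - gam * M ^+ 2 / 2) * gam ^+ 2 * vnorm (grad U x) ^+ 2
   - (9 / 8 / k + M / 2 + gam * M ^+ 2 / 2) * vnorm z ^+ 2 <= log_ratio gam x (vadd x v).
Proof.
move=> gam0 m0 M0 k0 v hH; set g := grad U x.
set y := vadd x v; set n := vnorm g ^+ 2; set nz := vnorm z ^+ 2.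
have n0 : 0 <= n by exact: sqr_ge0.
have nz0 : 0 <= nz by exact: sqr_ge0.
have psd t : 0 <= t <= 1 -> forall w, 0 <= hess U (vadd x (vscale t v)) w w.
  move=> /hH H w; have /andP[+ _] := H w; apply: le_trans.
  by rewrite mulr_ge0 ?sqr_ge0.
(* The integrand is bounded below by a t - b. F contains minus the antiderivative of that bound, so
   only the sign of [dF] at one point is needed. *)
pose a := gam ^+ 2 * m * n / 2.
pose b := k * M / 2 * gam ^+ 2 * M * n + 9 / 8 / k * nz + M * nz / 2.
pose F t := (t - 1 / 2) * dot (grad U (vadd x (vscale t v))) v - U (vadd x (vscale t v))
   - gam / 2 * dot (grad U (vadd x (vscale t v))) g - a / 2 * t ^+ 2 + b * t.
pose dF t := (t - 1 / 2) * hess U (vadd x (vscale t v)) v v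
   - gam / 2 * hess U (vadd x (vscale t v)) g v - a * t + b.
have FdF t : is_derive t 1 F (dF t).
  have h1 := is_derive_grad UC2 v v x t.
  have h2 := is_derive_grad UC2 v g x t.
  have h3 := is_derive_potential UC2 hessL v x t.
  pose f1 s := dot (grad U (vadd x (vscale s v))) v.
  pose f2 s := dot (grad U (vadd x (vscale s v))) g.
  pose f3 s := U (vadd x (vscale s v)).
  have : is_derive t 1 ((id - cst (1 / 2)) * f1 - f3 - (gam / 2) \*: f2 - (a / 2) \*: (id : R -> R) ^+ 2 + b \*: (id : R -> R)) (dF t).
    apply: is_derive_eq; rewrite /dF /GRing.scale /= /f1 !fctE.
    by field.
  by congr is_derive; apply/funext => s; rewrite /F !fctE.
have [c c01 hc] := MVT01 FdF.
have dF0 : 0 <= dF c.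
  have /andP[c0 c1] := c01.
  set p := vadd x (vscale c v).
  have /andP[hg1 hg2] := hH c c01 g; have /andP[hz1 hz2] := hH c c01 z.
  rewrite -/p -/n -/nz in hg1 hg2 hz1 hz2.
  have hzp := psd c c01 z; rewrite -/p in hzp.
  have Hv : hess U p v v = gam ^+ 2 * hess U p g g - 2 * gam * hess U p g z + hess U p z z.
    rewrite /v !(hessDl, hessDr UC2, hessZl, hessZr UC2) (hessC UC2 p z g); ring.
  have Hg : hess U p g v = - gam * hess U p g g + hess U p g z.
    by rewrite /v !(hessDl, hessDr UC2, hessZl, hessZr UC2).
  have kM : 0 < k * M by rewrite mulr_gt0.
  have qk : hess U p z z <= nz / k * (k * M).
    by apply: le_trans hz2 _; rewrite mulrA divfK ?gt_eqF// mulrC.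
  have := log_ratio_deriv gam0 kM c0 c1 hzp qk (fun s => hess_AMGM UC2 s g z (psd c c01)).
  rewrite -Hv -Hg /dF -/p.
  move: hg1 hg2 hz2; set h := hess U p g g; set q := hess U p z z => hg1 hg2 hz2.
  have e1 : 0 <= c / 2 * gam ^+ 2 * (h - m * n).
    by rewrite mulr_ge0 ?subr_ge0// mulr_ge0 ?sqr_ge0// divr_ge0.
  have e2 : 0 <= k * M / 2 * gam ^+ 2 * (M * n - h).
    by rewrite mulr_ge0 ?subr_ge0// mulr_ge0 ?sqr_ge0// divr_ge0// ltW.
  rewrite /a /b; set ik := k^-1; lra.
move: hc; rewrite /F line0 line1 -/y.
rewrite -/g expr1n expr0n /= => hc.
(* As in [grad_lipschitz], but with the constant M valid on the segment. *)
have Glip : vnorm (vadd (grad U y) (vopp g)) <= M * vnorm v.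
  set w := vadd (grad U y) _.
  have [e e01] := MVT01 (is_derive_grad UC2 v w x).
  rewrite line0 line1 -/y.
  move=> he.
  have : vnorm w ^+ 2 <= M * vnorm w * vnorm v.
    rewrite vnorm_sqr {1}/w dotDl dotNl he; apply: le_trans (ler_norm _) _.
    apply: (hess_CS UC2 hessL) => w'; rewrite (psd e e01)/=.
    by have /andP[] := hH e e01 w'.
  have := vnorm_ge0 w; rewrite le_eqVlt => /predU1P[<-|w0].
    by rewrite mulr_ge0 ?vnorm_ge0 ?(ltW M0).
  by rewrite expr2 -mulrA mulrCA ler_pM2l.
have vn : vnorm v ^+ 2 <= 2 * gam ^+ 2 * n + 2 * nz.
  have := dot_ge0 (vadd (vscale gam g) z).
  rewrite vnorm_sqr /v /n /nz !vnorm_sqr !(dotDl, dotDr, dotZl, dotZr) (dotC z g) -/g; lra.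
have Gn : vnorm (vadd (grad U y) (vopp g)) ^+ 2 <= M ^+ 2 * (2 * gam ^+ 2 * n + 2 * nz).
  apply: (@le_trans _ _ ((M * vnorm v) ^+ 2)).
    by rewrite ler_sqr ?nnegrE ?vnorm_ge0// mulr_ge0 ?vnorm_ge0// ltW.
  by rewrite exprMn ler_wpM2l// sqr_ge0.
have Gg : gam / 4 * vnorm (vadd (grad U y) (vopp g)) ^+ 2 <= gam / 4 * (M ^+ 2 * (2 * gam ^+ 2 * n + 2 * nz)).
  by rewrite ler_pM2l// divr_gt0.
rewrite log_ratioE -/g -/y.
rewrite -/g in hc *; rewrite /dF in hc dF0.
move: hc dF0; set X := (_ + b) => hc dF0.
have : 0 <= (1 - 1 / 2) * dot (grad U y) v - U y - gam / 2 * dot (grad U y) g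
   - ((0 - 1 / 2) * dot g v - U x - gam / 2 * dot g g) - a / 2 + b.
  apply: le_trans dF0 _; rewrite -hc; lra.
set Y := (_ - ((0 - 1 / 2) * dot g v - U x - gam / 2 * dot g g)).
rewrite /a /b; lra.
Qed.

End log_acceptance.

(** * Growth of the potential and of its gradient *)

Section growth.
Variables (R : realType) (d : nat) (U : d.-tuple R -> R) (beta L mb Lb Kb : R).
Notation Rd := (d.-tuple R).
Implicit Types (x y z v w : Rd) (s t : R).
Hypothesis beta01 : 0 <= beta < 1.
Hypothesis UC2 : C2 U.
Hypothesis grad0 : forall i, partial U i (origin R d) = 0.
Hypothesis L_ge0 : 0 <= L.
Hypothesis hessL : forall x y z, `|hess U x y z| <= L * vnorm y * vnorm z.
Hypothesis mb_gt0 : 0 < mb.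
Hypothesis Lb_ge0 : 0 <= Lb.
Hypothesis Kb_ge0 : 0 <= Kb.
Hypothesis hessB : forall x y, Kb <= vnorm x -> vnorm y = 1 ->
     hess U x y y <= Lb / (1 + vnorm x `^ (3 * beta / 4)) /\
     mb / (1 + vnorm x `^ beta) <= hess U x y y.

Let beta0 : 0 <= beta. Proof. by have /andP[] := beta01. Qed.

Lemma pow1D_gt0 (a b : R) : 0 < 1 + a `^ b.
Proof. by rewrite ltr_pwDl// powR_ge0. Qed.

Lemma hess_quad_far x w : Kb <= vnorm x ->
  mb / (1 + vnorm x `^ beta) * vnorm w ^+ 2 <= hess U x w w
    <= Lb / (1 + vnorm x `^ (3 * beta / 4)) * vnorm w ^+ 2.
Proof.
move=> xK.
have [h1 h2] := hess_quad UC2 hessL (fun y => @hessB x y xK) w.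
by rewrite h1 h2.
Qed.

(** Lb + 1 in place of Lb makes the upper bound positive. The factor 4 absorbs the passage from
    radius s to 4 s, as 4^beta <= 4. *)
Let C0 := 4 * (Lb + 1) ^+ 2 / mb.
Let C0_gt0 : 0 < C0.
Proof.
have B0 : 0 < Lb + 1 by move: Lb_ge0; lra.
by rewrite /C0 divr_gt0// mulr_gt0// exprn_gt0.
Qed.

(* This is where the exponent 3 beta / 4 >= beta / 2 of the upper bound on the
   Hessian is used. *)
Lemma sqr_upper_le_lower s : 1 <= s ->
  ((Lb + 1) / (1 + s `^ (3 * beta / 4))) ^+ 2 <= C0 * (mb / (1 + (4 * s) `^ beta)).
Proof.
have b0 := beta0; have Lb0 := Lb_ge0; have L0 := L_ge0; have K0' := Kb_ge0.
move=> s1; have s0 : 0 < s by lra.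
have /andP[_ beta1] := beta01.
have p1 := pow1D_gt0 s (3 * beta / 4); have p2 := pow1D_gt0 (4 * s) beta.
rewrite expr_div_n.
have -> : C0 * (mb / (1 + (4 * s) `^ beta)) = (Lb + 1) ^+ 2 * (4 / (1 + (4 * s) `^ beta)).
  rewrite /C0; field; rewrite gt_eqF ?gt_eqF// gt_eqF//.
rewrite ler_wpM2l ?sqr_ge0// -[leRHS]invf_div lef_pV2 ?posrE ?divr_gt0 ?exprn_gt0//.
rewrite ler_pdivrMr//.
have h4 : (4 * s) `^ beta <= 4 * s `^ beta.
  rewrite powRM//; [|lra..]; rewrite ler_wpM2r ?powR_ge0//.
  by rewrite -[leRHS]powRr1// ler_powR; lra.
have hb : s `^ beta <= (s `^ (3 * beta / 4)) ^+ 2.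
  rewrite -powR_mulrn ?powR_ge0// -powRrM; apply: ler_powR => //; lra.
have := powR_ge0 s (3 * beta / 4); nra.
Qed.

(** For large x the whole segment to the proposal lies at radii between s = |x| / 2 and 4 s, so that
    one pair m, M with M^2 <= C0 m serves on it. The coefficient of |grad U x|^2 in
    [log_ratio_lower] is then nonnegative, and what remains is bounded uniformly in x. *)
Lemma log_ratio_far (gam rho : R) : 0 < gam -> gam * L <= 1 / 4 -> gam * C0 <= 1 / 4 -> 0 <= rho ->
  exists K c : R, forall x z, K <= vnorm x -> vnorm z <= rho ->
    - c <= log_ratio U gam x (vadd x (vadd (vscale (- gam) (grad U x)) z)).
Proof.
have b0 := beta0; have Lb0 := Lb_ge0; have L0 := L_ge0; have K0' := Kb_ge0.
move=> gam0 gamL gamC rho0.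
(* Makes k M^2 / 2 <= m / 8. The condition on gam C0 gives the same for gam M^2 / 2, and together
   they use up m / 4. *)
pose k := (4 * C0)^-1.
have k0 : 0 < k by rewrite invr_gt0 mulr_gt0.
have kC : k * C0 = 1 / 4 by rewrite /k; field; rewrite gt_eqF.
pose B := Lb + 1.
have B0 : 0 < B by rewrite /B; lra.
(* These bounds give s >= Kb, rho <= |x| / 4 and s >= 1. *)
pose K := Num.max (2 * Kb) (Num.max (4 * rho) 2).
exists K, ((9 / 8 / k + B / 2 + gam * B ^+ 2 / 2) * rho ^+ 2) => x z.
rewrite !ge_max => /and3P[xKb xrho x2] zrho.
set v := vadd (vscale _ _) z.
pose s := vnorm x / 2.
have s1 : 1 <= s by rewrite /s; lra.
have vn : vnorm v <= s.
  apply: le_trans (vnorm_vadd _ _) _; rewrite vnorm_vscale normrN gtr0_norm//.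
  have := grad_le UC2 L_ge0 grad0 hessL x.
  move=> /(ler_wpM2l (ltW gam0)); rewrite mulrA => h.
  have := ler_wpM2r (vnorm_ge0 x) gamL; rewrite /s; lra.
pose m := mb / (1 + (4 * s) `^ beta).
pose M := B / (1 + s `^ (3 * beta / 4)).
have p1 := pow1D_gt0 s (3 * beta / 4); have p2 := pow1D_gt0 (4 * s) beta.
have m0 : 0 < m by rewrite divr_gt0.
have M0 : 0 < M by rewrite divr_gt0.
have MB : M <= B.
  by rewrite /M ler_pdivrMr// ler_peMr ?(ltW B0)// lerDl powR_ge0.
have M2 : M ^+ 2 <= C0 * m by exact: sqr_upper_le_lower.
have hH t : 0 <= t <= 1 -> forall w, m * vnorm w ^+ 2 <= hess U (vadd x (vscale t v)) w w
     <= M * vnorm w ^+ 2.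
  move=> /andP[t0 t1] w; set p := vadd x _.
  have tv : vnorm (vscale t v) <= s.
    rewrite vnorm_vscale ger0_norm//; apply: le_trans vn.
    by rewrite -[leRHS]mul1r ler_wpM2r ?vnorm_ge0.
  have ps : s <= vnorm p.
    have : vnorm x <= vnorm p + vnorm (vscale t v).
      rewrite -(vnorm_vopp (vscale t v)).
      have {1}-> : x = vadd p (vopp (vscale t v)).
        by apply: eq_from_tnth => i; rewrite !tnth_vadd tnth_vopp addrK.
      exact: vnorm_vadd.
    rewrite /s in tv *; lra.
  have p4 : vnorm p <= 4 * s by apply: le_trans (vnorm_vadd _ _) _; rewrite /s in tv *; lra.
  have pK : Kb <= vnorm p by apply: le_trans ps; rewrite /s; lra.
  have /andP[h1 h2] := hess_quad_far w pK.
  have q1 := pow1D_gt0 (vnorm p) (3 * beta / 4); have q2 := pow1D_gt0 (vnorm p) beta.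
  apply/andP; split.
    apply: le_trans h1; rewrite ler_wpM2r ?sqr_ge0// /m ler_pM2l// lef_pV2 ?posrE//.
    by rewrite lerD2l ge0_ler_powR// nnegrE ?vnorm_ge0//; lra.
  apply: le_trans h2 _; rewrite ler_wpM2r ?sqr_ge0//.
  apply: ler_pM; rewrite ?invr_ge0 ?(ltW q1)// /B; first by lra.
  rewrite lef_pV2 ?posrE// lerD2l ge0_ler_powR// ?nnegrE ?vnorm_ge0//; lra.
have := log_ratio_lower UC2 hessL gam0 (ltW m0) M0 k0 hH.
apply: le_trans.
set n := vnorm (grad U x) ^+ 2; set nz := vnorm z ^+ 2.
have e1 : 0 <= (m / 4 - k * M ^+ 2 / 2 - gam * M ^+ 2 / 2) * gam ^+ 2 * n.
  rewrite mulr_ge0 ?sqr_ge0// mulr_ge0 ?sqr_ge0//.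
  have h1 : k * M ^+ 2 <= m / 4.
    by apply: le_trans (ler_wpM2l (ltW k0) M2) _; rewrite (mulrA k C0 m) kC; lra.
  have h2 : gam * M ^+ 2 <= m / 4.
    apply: le_trans (ler_wpM2l (ltW gam0) M2) _; rewrite (mulrA gam C0 m).
    by apply: le_trans (ler_wpM2r (ltW m0) gamC) _; lra.
  lra.
have nzr : nz <= rho ^+ 2 by rewrite ler_sqr ?nnegrE ?vnorm_ge0.
have M2B : M ^+ 2 <= B ^+ 2 by rewrite ler_sqr ?nnegrE ?(ltW M0) ?(ltW B0).
have e2 : (9 / 8 / k + M / 2 + gam * M ^+ 2 / 2) * nz <= (9 / 8 / k + B / 2 + gam * B ^+ 2 / 2) * rho ^+ 2.
  have ik : 0 <= 9 / 8 / k by rewrite divr_ge0 ?(ltW k0).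
  have gM := ler_wpM2l (ltW gam0) M2B.
  have gM0 : 0 <= gam * M ^+ 2 by rewrite mulr_ge0 ?sqr_ge0 ?(ltW gam0).
  apply: ler_pM; rewrite ?sqr_ge0//; lra.
lra.
Qed.

Let L' := L + 1.
Let L'_gt0 : 0 < L'. Proof. by move: L_ge0; rewrite /L'; lra. Qed.

Let K1 := Num.max Kb 1.
Let K1_ge1 : 1 <= K1. Proof. by rewrite le_max lexx orbT. Qed.
Let K1_geKb : Kb <= K1. Proof. by rewrite le_max lexx. Qed.

(* The part of the ray through x lying outside the ball of radius a, as the
   segment from (a / |x|) x to x. *)
Lemma ray_segment x (a : R) : 0 < a -> a <= vnorm x ->
  let v := vscale (1 - a / vnorm x) x in
  exists2 p, vnorm p = a & [/\ vadd p v = x, vnorm v = vnorm x - a &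
    forall t, 0 <= t <= 1 -> exists2 s, 0 < s & vadd p (vscale t v) = vscale s x /\
      a <= vnorm (vadd p (vscale t v)) <= vnorm x].
Proof.
move=> a0 ax v; have x0 : 0 < vnorm x by lra.
have ax0 : 0 < a / vnorm x by rewrite divr_gt0.
have ax1 : a / vnorm x <= 1 by rewrite ler_pdivrMr// mul1r.
have axE : a / vnorm x * vnorm x = a by rewrite divfK// gt_eqF.
exists (vscale (a / vnorm x) x); first by rewrite vnorm_vscale gtr0_norm.
split=> [||t /andP[t0 t1]].
- by apply: eq_from_tnth => i; rewrite !tnthE; ring.
- by rewrite vnorm_vscale ger0_norm ?subr_ge0// mulrBl mul1r axE.
pose s := a / vnorm x + t * (1 - a / vnorm x).
have E : vadd (vscale (a / vnorm x) x) (vscale t v) = vscale s x.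
  by apply: eq_from_tnth => i; rewrite !tnthE /s; ring.
have ts : 0 <= t * (1 - a / vnorm x) by rewrite mulr_ge0// subr_ge0.
have s0 : 0 < s by rewrite /s; lra.
exists s => //; rewrite E vnorm_vscale gtr0_norm//; split=> //; apply/andP; split.
  by rewrite -{1}axE ler_wpM2r ?(ltW x0)// /s; lra.
rewrite -[leRHS]mul1r ler_wpM2r ?(ltW x0)// /s; nra.
Qed.

(* Taylor along the ray outside the ball where the Hessian is nonnegative, with
   2 H g v <= H g g / L' + L' H v v: this is cocoercivity up to a linear term. *)
Lemma grad_cocoercive x : K1 <= vnorm x -> 0 <= dot (grad U x) x ->
  vnorm (grad U x) ^+ 2 <= L' * dot (grad U x) x + 3 * L' ^+ 2 * K1 * vnorm x.
Proof.
have b0 := beta0; have L0 := L_ge0; have L'0 := L'_gt0; have K1g := K1_ge1.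
move=> xK G0; set g := grad U x.
have K10 : 0 < K1 by lra.
have [p pK [pv vn hp]] := ray_segment K10 xK.
set v := vscale _ x in pv vn hp; set r := vnorm x in xK vn hp *.
have LL : L <= L' by rewrite /L'; lra.
have gr : vnorm g <= L' * r.
  by apply: le_trans (grad_le UC2 L_ge0 grad0 hessL x) _; rewrite ler_wpM2r ?vnorm_ge0.
have gp : vnorm (grad U p) <= L' * K1.
  rewrite -pK; apply: le_trans (grad_le UC2 L_ge0 grad0 hessL p) _; by rewrite ler_wpM2r ?vnorm_ge0.
(* F 1 contains - |g|^2, while the derivative of F is at least - |g|^2 / 2: half of |g|^2 remains.
   The values at p, on the sphere of radius K1, form the linear error. *)
pose F t := L' / 2 * dot (grad U (vadd p (vscale t v))) v - dot (grad U (vadd p (vscale t v))) g.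
pose dF t := L' / 2 * hess U (vadd p (vscale t v)) v v - hess U (vadd p (vscale t v)) g v.
have FdF t : is_derive t 1 F (dF t).
  have h1 := is_derive_grad UC2 v v p t.
  have h2 := is_derive_grad UC2 v g p t.
  by have := is_deriveB (is_deriveZ (L' / 2) h1) h2.
have [c c01 hc] := MVT01 FdF.
have [s s0 [_ /andP[pc1 pc2]]] := hp c c01.
set q := vadd p (vscale c v) in pc1 pc2.
have psd w : 0 <= hess U q w w.
  have /andP[+ _] := hess_quad_far w (le_trans K1_geKb pc1).
  apply: le_trans; rewrite mulr_ge0 ?sqr_ge0// divr_ge0 ?(ltW mb_gt0)// ltW//; exact: pow1D_gt0.
have : - (1 / 2 * vnorm g ^+ 2) <= dF c.
  rewrite /dF -/q.
  have := hess_AMGM UC2 L' v g psd; rewrite ler_norml => /andP[_].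
  rewrite (hessC UC2 q v g) => h.
  have hgg : hess U q g g <= L' * vnorm g ^+ 2.
    apply: le_trans (ler_norm _) _; apply: le_trans (hessL _ _ _) _.
    by rewrite -mulrA -expr2 ler_wpM2r ?sqr_ge0.
  rewrite -(ler_pM2l L'_gt0).
  move: h hgg; set a := hess U q v v; set b := hess U q g v; set e := hess U q g g; lra.
rewrite -hc /F line0 line1 pv -/g -vnorm_sqr.
have gx : dot g v <= dot g x.
  rewrite /v dotZr -[leRHS]mul1r ler_wpM2r// gerBl divr_ge0 ?vnorm_ge0//; lra.
have vr : vnorm v <= r by lra.
have r0 : 0 <= r by exact: vnorm_ge0.
have LK0 : 0 <= L' * K1 by rewrite mulr_ge0// ltW.
have d1 : dot (grad U p) g <= L' * K1 * (L' * r).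
  by apply: le_trans (dot_le _ _) _; apply: ler_pM; rewrite ?vnorm_ge0.
have d2 : - dot (grad U p) v <= L' * K1 * r.
  rewrite -dotNl; apply: le_trans (dot_le _ _) _; rewrite vnorm_vopp.
  by apply: ler_pM; rewrite ?vnorm_ge0.
have L20 : 0 <= L' / 2 by lra.
have := ler_wpM2l L20 d2; have := ler_wpM2l L20 gx; lra.
Qed.

(** Outside radius K1 the Hessian along the ray to x is at least mb / (2 r^beta) with r = |x|, so
    the radial part of the gradient grows at least like r^(1 - beta), which is unbounded as beta <
    1. *)
Lemma grad_growth (A : R) : exists2 K, 1 <= K & forall x, K <= vnorm x ->
  A * vnorm x <= dot (grad U x) x.
Proof.
have b0 := beta0; have L0 := L_ge0; have L'0 := L'_gt0; have K1g := K1_ge1.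
have /andP[_ beta1] := beta01.
(* The threshold for r^(1 - beta): (mb / 4) Q covers A and the loss L' K1 from the gradient at p. *)
pose Q := Num.max 1 (4 * (A + L' * K1) / mb).
have Q1 : 1 <= Q by rewrite le_max lexx.
have Q0 : 0 < Q by lra.
have QA : 4 * (A + L' * K1) <= Q * mb.
  by rewrite -ler_pdivrMr// /Q le_max lexx orbT.
exists (Num.max (2 * K1) (Q `^ (1 - beta)^-1)); first by rewrite le_max; apply/orP; left; lra.
move=> x; rewrite ge_max => /andP[xK xQ]; set r := vnorm x in xK xQ *.
have r0 : 0 < r by lra.
have xK1 : K1 <= vnorm x by rewrite -/r; lra.
have K10 : 0 < K1 by lra.
have [p pK [pv vn hp]] := ray_segment K10 xK1.
set v := vscale _ x in pv vn hp; rewrite -/r in vn hp.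
have LL : L <= L' by rewrite /L'; lra.
have gp : vnorm (grad U p) <= L' * K1.
  rewrite -pK; apply: le_trans (grad_le UC2 L_ge0 grad0 hessL p) _; by rewrite ler_wpM2r ?vnorm_ge0.
have [c c01] := MVT01 (is_derive_grad UC2 v v p).
rewrite line0 line1 pv.
have [s s0 [_ /andP[pc1 pc2]]] := hp c c01.
set q := vadd p (vscale c v) in pc1 pc2 * => hc.
have /andP[+ _] := hess_quad_far v (le_trans K1_geKb pc1).
rewrite -hc vn => hm.
have rb1 : 1 <= r `^ beta by rewrite -(powRr0 r) ler_powR//; lra.
have rb : r = r `^ beta * r `^ (1 - beta).
  by rewrite -powRD ?(gt_eqF r0) ?implybT// addrC subrK powRr1// ltW.
have Qr : Q <= r `^ (1 - beta).
  have -> : Q = (Q `^ (1 - beta)^-1) `^ (1 - beta).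
    by rewrite -powRrM mulVf ?powRr1 ?(ltW Q0)// subr_eq0 gt_eqF.
  by rewrite ge0_ler_powR// ?nnegrE ?powR_ge0 ?(ltW r0)//; lra.
have m1 : mb / 2 / r `^ beta <= mb / (1 + vnorm q `^ beta).
  have rbp : 0 < r `^ beta by lra.
  rewrite -mulrA -invfM ler_pM2l// lef_pV2 ?posrE ?pow1D_gt0 ?mulr_gt0//.
  have : vnorm q `^ beta <= r `^ beta by rewrite ge0_ler_powR// nnegrE ?vnorm_ge0// ltW.
  lra.
have rK : 0 < r - K1 by lra.
have h1 : mb / 2 / r `^ beta * (r - K1) ^+ 2 <= dot (grad U x) v - dot (grad U p) v.
  by apply: le_trans hm; rewrite ler_wpM2r ?sqr_ge0.
have h2 : - dot (grad U p) v <= L' * K1 * (r - K1).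
  rewrite -dotNl; apply: le_trans (dot_le _ _) _; rewrite vnorm_vopp vn.
  by rewrite ler_wpM2r// ltW.
have vx : dot (grad U x) v = (r - K1) / r * dot (grad U x) x.
  by rewrite /v dotZr -/r; congr (_ * _); field; rewrite gt_eqF.
have h3 : mb / 2 / r `^ beta * (r - K1) - L' * K1 <= dot (grad U x) x / r.
  rewrite -(ler_pM2l rK).
  have -> : (r - K1) * (dot (grad U x) x / r) = dot (grad U x) v by rewrite vx; ring.
  lra.
rewrite -ler_pdivlMr//; apply: le_trans h3.
have h4 : mb / 2 / r `^ beta * (r / 2) <= mb / 2 / r `^ beta * (r - K1).
  by rewrite ler_wpM2l//; [rewrite !divr_ge0 ?powR_ge0 ?(ltW mb_gt0)|lra].
have h5 : mb / 2 / r `^ beta * (r / 2) = mb / 4 * r `^ (1 - beta).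
  by rewrite {2}rb; field; rewrite gt_eqF//; lra.
have := ler_wpM2l (ltW mb_gt0) Qr; lra.
Qed.

(** In |x - gam g|^2 = r^2 - 2 gam <g, x> + gam^2 |g|^2, cocoercivity and gam L' <= 1 let one of the
    two copies of gam <g, x> absorb the last term up to a linear error; the other copy pays for that
    error and for 2 D r. *)
Lemma drift_contract (gam D : R) : 0 < gam -> gam * (L + 1) <= 1 -> exists2 K, 1 <= K &
  forall x, K <= vnorm x -> vnorm (vadd x (vscale (- gam) (grad U x))) <= vnorm x - D.
Proof.
have b0 := beta0; have L0 := L_ge0; have L'0 := L'_gt0; have K1g := K1_ge1.
move=> gam0 gamL.
pose D' := Num.max D 0.
have D'0 : 0 <= D' by rewrite le_max lexx orbT.
have DD' : D <= D' by rewrite le_max lexx.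
(* gam A r is exactly the linear error of [grad_cocoercive] times gam^2, plus 2 D' r. *)
pose A := 3 * gam * L' ^+ 2 * K1 + 2 * D' / gam.
have A0 : 0 <= A.
  rewrite /A addr_ge0 ?divr_ge0 ?mulr_ge0 ?sqr_ge0 ?(ltW gam0)//; lra.
have [K K_ge1 hK] := grad_growth A.
exists (Num.max K (Num.max K1 D')); first by rewrite le_max K_ge1.
move=> x; rewrite ge_max => /andP[xK]; rewrite ge_max => /andP[xK1 xD].
have G := hK x xK.
have G0 : 0 <= dot (grad U x) x by apply: le_trans G; rewrite mulr_ge0 ?vnorm_ge0.
have := grad_cocoercive xK1 G0.
move: G G0; rewrite -/L' in gamL; set g := grad U x; set r := vnorm x in xK xK1 xD * => G G0 coc.
apply: (@le_trans _ _ (r - D')); last by lra.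
rewrite -ler_sqr ?nnegrE ?vnorm_ge0 ?subr_ge0//.
rewrite vnorm_sqr !(dotDl, dotDr, dotZl, dotZr) -!vnorm_sqr -/r (dotC x g).
have h1 := ler_wpM2l (sqr_ge0 gam) coc.
have h2 := ler_wpM2l (ltW gam0) G.
have h3 : gam * (A * r) = 3 * gam ^+ 2 * L' ^+ 2 * K1 * r + 2 * D' * r.
  by rewrite /A; field; rewrite gt_eqF.
have h4 : gam ^+ 2 * (L' * dot g x) <= gam * dot g x.
  rewrite expr2 -mulrA ler_pM2l// mulrA -[leRHS]mul1r; exact: ler_wpM2r.
have := sqr_ge0 D'; lra.
Qed.

(** By [grad_growth] the radial derivative of U is at least A outside a ball; inside, U is bounded.
    Arbitrary slopes are needed to integrate W against exp (- U). *)
Lemma potential_growth (A : R) : 0 <= A -> exists B, forall x, A * vnorm x - B <= U x.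
Proof.
have b0 := beta0; have L0 := L_ge0; have L'0 := L'_gt0; have K1g := K1_ge1.
move=> A0; have [K K_ge1 hK] := grad_growth A.
have K0 : 0 < K by lra.
exists (A * K + L * K ^+ 2 - U (origin R d)) => x.
have near0 p : vnorm p <= K -> U (origin R d) - L * K ^+ 2 <= U p.
  move=> pK; have := potential_le UC2 L_ge0 grad0 hessL p; rewrite ler_norml => /andP[h _].
  have : L * vnorm p ^+ 2 <= L * K ^+ 2.
    by rewrite ler_wpM2l// ler_sqr ?nnegrE ?vnorm_ge0// ltW.
  lra.
have [xK|/ltW xK] := lerP (vnorm x) K.
  have := near0 x xK; have := ler_wpM2l A0 xK; lra.
have [p pK [pv vn hp]] := ray_segment K0 xK.
set v := vscale _ x in pv vn hp; set r := vnorm x in xK vn hp *.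
have [c c01] := MVT01 (is_derive_potential UC2 hessL v p).
rewrite line0 line1 pv.
have [s s0 [qE /andP[pc1 pc2]]] := hp c c01.
set q := vadd p (vscale c v) in qE pc1 pc2 * => hc.
have r0 : 0 < r by lra.
have qr : vnorm q = s * r by rewrite qE vnorm_vscale gtr0_norm.
(* q lies on the ray of x, so v is a nonnegative multiple of q and the growth bound at q applies. *)
have xE : v = vscale ((r - K) / r / s) q.
  rewrite qE; apply: eq_from_tnth => i; rewrite !tnth_vscale -/r; field.
  by rewrite !gt_eqF.
have co : 0 <= (r - K) / r / s.
  by rewrite divr_ge0 ?(ltW s0)// divr_ge0 ?(ltW r0)// subr_ge0.
have : A * (r - K) <= dot (grad U q) v.
  rewrite xE dotZr; have := ler_wpM2l co (hK q pc1).
  rewrite qr; apply: le_trans.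
  rewrite le_eqVlt; apply/orP; left; apply/eqP; field.
  by rewrite !gt_eqF.
have := near0 p; rewrite pK lexx => /(_ isT); lra.
Qed.

End growth.

(** * Harris' theorem *)

Section harris.
Variables (R : realType) (T : Type) (F : (T -> R) -> Prop).
Hypothesis F_lin : forall a f g, F f -> F g -> F (fun x => a * f x + g x).
Hypothesis F_cst : forall c : R, F (fun=> c).

(* Unlike for a Markov operator, [q 1] is arbitrary: this leaves room for the
   residual operator after subtracting a minorizing measure. *)
Definition positive_linear (q : (T -> R) -> R) : Prop :=
  (forall a f g, F f -> F g -> q (fun x => a * f x + g x) = a * q f + q g) /\
  (forall f, F f -> (forall x, 0 <= f x) -> 0 <= q f).

Lemma class_add f g : F f -> F g -> F (fun x => f x + g x).
Proof.
move=> Ff Fg; have := F_lin 1 Ff Fg.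
by congr F; apply/funext => x; rewrite mul1r.
Qed.

Lemma class_scale a f : F f -> F (fun x => a * f x).
Proof.
move=> Ff; have := F_lin a Ff (F_cst 0).
by congr F; apply/funext => x; rewrite addr0.
Qed.

Lemma positive_linearD q f g : positive_linear q -> F f -> F g ->
  q (fun x => f x + g x) = q f + q g.
Proof.
move=> [ql _] Ff Fg; have := ql 1 f g Ff Fg; rewrite mul1r => <-.
by congr q; apply/funext => x; rewrite mul1r.
Qed.

Lemma positive_linearZ q a f : positive_linear q -> F f ->
  q (fun x => a * f x) = a * q f.
Proof.
move=> [ql _] Ff.
have q0 : q (fun=> 0) = 0.
  have := ql 1 (fun=> 0) (fun=> 0) (F_cst _) (F_cst _).
  rewrite (_ : (fun _ => _) = fun=> 0); first by lra.
  by apply/funext => x; rewrite mulr0 addr0.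
have := ql a f (fun=> 0) Ff (F_cst 0); rewrite q0 addr0 => <-.
by congr q; apply/funext => x; rewrite addr0.
Qed.

Lemma positive_linear_cst q c : positive_linear q -> q (fun=> c) = c * q (fun=> 1).
Proof.
move=> ql; rewrite -positive_linearZ//.
by congr q; apply/funext => x; rewrite mulr1.
Qed.

Variable W : T -> R.
Hypothesis F_W : F W.
Hypothesis W_ge1 : forall x, 1 <= W x.

(* Integrating [phi u - phi w <= 2 + beta * W u + beta * W w] first in [u],
   then in [w]. *)
Lemma positive_linear_osc (q1 q2 : (T -> R) -> R) (m beta : R) (phi : T -> R) :
  positive_linear q1 -> positive_linear q2 -> 0 < m ->
  q1 (fun=> 1) = m -> q2 (fun=> 1) = m -> F phi ->
  (forall u w, phi u - phi w <= 2 + beta * W u + beta * W w) ->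
  q1 phi - q2 phi <= 2 * m + beta * q1 W + beta * q2 W.
Proof.
move=> q1P q2P m0 q11 q21 Fphi osc.
have step1 w : 0 <= m * (2 + beta * W w + phi w) + beta * q1 W - q1 phi.
  have := (proj2 q1P)
    (fun u => beta * W u + (-1 * phi u + (2 + beta * W w + phi w))).
  rewrite (proj1 q1P)//; last by apply: F_lin.
  rewrite (proj1 q1P)// (positive_linear_cst _ q1P) q11 => H.
  have : 0 <= beta * q1 W + (-1 * q1 phi + (2 + beta * W w + phi w) * m).
    apply: H; first by do !apply: F_lin => //.
    by move=> u; have := osc u w; lra.
  by move=> h; apply: le_trans h _; lra.
pose c := 2 * m + beta * q1 W - q1 phi.
have := (proj2 q2P) (fun w => m * beta * W w + (m * phi w + c)).
rewrite (proj1 q2P)//; last by apply: F_lin.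
rewrite (proj1 q2P)// (positive_linear_cst _ q2P) q21 => H.
have {}H : 0 <= m * beta * q2 W + (m * q2 phi + c * m).
  apply: H; first by do !apply: F_lin => //.
  move=> w; apply: le_trans (step1 w) _; rewrite /c; lra.
have : 0 <= m * (beta * q2 W + q2 phi + c) by apply: le_trans H _; lra.
by rewrite pmulr_rge0// /c; lra.
Qed.

Variables (P : (T -> R) -> T -> R) (nu pi : (T -> R) -> R).
Hypothesis F_P : forall f, F f -> F (P f).
Hypothesis P_pos : forall x, positive_linear (P^~ x).
Hypothesis P1 : forall x, P (fun=> 1) x = 1.
Hypothesis nu_pos : positive_linear nu.
Hypothesis nu1 : nu (fun=> 1) = 1.
Hypothesis pi_pos : positive_linear pi.
Hypothesis pi1 : pi (fun=> 1) = 1.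
Hypothesis piP : forall f, F f -> pi (P f) = pi f.
Variables (lambda b : R).
Hypothesis lambda_bnd : 0 <= lambda < 1.
Hypothesis b_gt0 : 0 < b.
Hypothesis drift : forall x, P W x <= lambda * W x + b.
Hypothesis minor : forall r, exists2 e, 0 < e & forall x f, W x <= r ->
  F f -> (forall y, 0 <= f y) -> e * nu f <= P f x.

Let W_ge0 x : 0 <= W x. Proof. by apply: le_trans (W_ge1 x). Qed.

(** If W u + W w >= r, the drift contracts the weight. Otherwise both points lie in the sublevel
    set, and subtracting e nu from both kernels lowers the mass. *)
Lemma harris_contraction : exists2 beta : R, 0 < beta & exists2 rho : R, 0 <= rho < 1 &
  forall phi M, 0 <= M -> F phi ->
  (forall u w, phi u - phi w <= M * (2 + beta * W u + beta * W w)) ->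
  forall u w, P phi u - P phi w <= rho * M * (2 + beta * W u + beta * W w).
Proof.
have [lambda0 lambda1] := andP lambda_bnd.
(* At W u + W w = r the drift gains (1 - lambda) r = 4 b, twice the constant 2 b it costs. *)
pose r := 4 * b / (1 - lambda).
have l1 : 0 < 1 - lambda by lra.
have r0 : 0 < r by rewrite /r divr_gt0// mulr_gt0.
have [e0 e0_gt0 he0] := minor r.
(* The cap keeps the residual mass 1 - e positive. *)
pose e := Num.min e0 (1/2).
have e_gt0 : 0 < e by rewrite lt_min e0_gt0/=; lra.
have e_le : e <= 1/2 by rewrite ge_min lexx orbT.
have he x f : W x <= r -> F f -> (forall y, 0 <= f y) -> e * nu f <= P f x.
  move=> xr Ff f0; apply: le_trans (he0 x f xr Ff f0).
  by rewrite ler_wpM2r ?(proj2 nu_pos)// ge_min lexx.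
(* Near case: the mass gain is 2 e, and the drift constant 2 beta b costs only e of it. *)
pose beta := e / (2 * b).
have beta_gt0 : 0 < beta by rewrite divr_gt0// mulr_gt0.
have betab : 2 * (beta * b) = e by rewrite /beta; field; rewrite gt_eqF.
(* Solves the far case with equality at the boundary: delta (2 + beta r) = 2 beta b. *)
pose delta := 2 * b / (r + 2 / beta).
have b2 : 0 < 2 / beta by rewrite divr_gt0.
have delta_gt0 : 0 < delta by rewrite divr_gt0 ?mulr_gt0// addr_gt0.
have deltaE : delta * (r + 2 / beta) = 2 * b by rewrite /delta divfK// gt_eqF// addr_gt0.
have rE : r * (1 - lambda) = 4 * b by rewrite /r divfK// gt_eqF.
have delta_le : delta <= (1 - lambda) / 2.
  have : delta * r <= (1 - lambda) / 2 * r.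
    apply: (@le_trans _ _ (2 * b)); last by lra.
    by rewrite -deltaE ler_wpM2l ?(ltW delta_gt0)//; lra.
  by rewrite ler_pM2r.
pose rho := Num.max (1 - delta) (Num.max (1 - e / 2) lambda).
exists beta => //; exists rho.
  rewrite /rho !le_max !gt_max; apply/andP; split.
    by rewrite lambda0 !orbT.
  by apply/and3P; split => //; lra.
have rho1 : 1 - delta <= rho by rewrite /rho le_max lexx.
have rho2 : 1 - e / 2 <= rho by rewrite /rho !le_max lexx orbT.
have rho3 : lambda <= rho by rewrite /rho !le_max lexx !orbT.
suff main phi : F phi -> (forall u w, phi u - phi w <= 2 + beta * W u + beta * W w) ->
    forall u w, P phi u - P phi w <= rho * (2 + beta * W u + beta * W w).
  move=> phi M M0 Fphi osc u w.
  (* Scaling reduces to M = 1; for M = 0 the function phi is constant, and so is P phi. *)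
  have [M_gt0|M_le0] := ltP 0 M; last first.
    have ME : M = 0 by lra.
    have phiE : phi = fun=> phi w.
      apply/funext => z; have := osc z w; have := osc w z; rewrite ME !mul0r; lra.
    have PE z : P phi z = phi w.
      by rewrite phiE (positive_linear_cst (phi w) (P_pos z)) P1 mulr1.
    by rewrite !PE ME mulr0 mul0r subrr.
  have := main (fun x => M^-1 * phi x) (class_scale _ Fphi) _ u w.
  rewrite !(positive_linearZ _ (P_pos _))// => H.
  have {}H : M^-1 * P phi u - M^-1 * P phi w <= rho * (2 + beta * W u + beta * W w).
    apply: H => u' w'; rewrite -mulrBr mulrC ler_pdivrMr//.
    by rewrite mulrC; apply: osc.
  move: H; rewrite -mulrBr mulrC ler_pdivrMr// => H.
  by apply: le_trans H _; lra.
move=> Fphi osc u w.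
have S0 : 0 <= beta * (W u + W w) by rewrite mulr_ge0 ?(ltW beta_gt0)// addr_ge0.
have dr : beta * (P W u + P W w) <= beta * (lambda * (W u + W w) + 2 * b).
  by rewrite ler_pM2l//; have := drift u; have := drift w; lra.
have far : r <= W u + W w -> P phi u - P phi w <= rho * (2 + beta * W u + beta * W w).
  move=> Sr.
  have := positive_linear_osc (P_pos u) (P_pos w) ltr01 (P1 u) (P1 w) Fphi osc.
  have := ler_wpM2r S0 rho1.
  have : beta * ((1 - lambda - delta) * r) <= beta * ((1 - lambda - delta) * (W u + W w)).
    by rewrite ler_pM2l// ler_wpM2l//; lra.
  have : beta * (delta * (r + 2 / beta)) = delta * (beta * r) + 2 * delta.
    by field; rewrite gt_eqF.
  rewrite deltaE.
  have -> : beta * ((1 - lambda - delta) * r) = beta * (r * (1-lambda)) - delta * (beta * r).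
    by ring.
  rewrite rE; lra.
have [ur|ur] := lerP (W u) r; have [wr|wr] := lerP (W w) r; first last.
- by apply: far; have := W_ge0 u; lra.
- by apply: far; have := W_ge0 w; lra.
- by apply: far; have := W_ge0 u; lra.
- have resid x : W x <= r -> positive_linear (fun f => P f x - e * nu f).
    move=> xr; split=> [a f g Ff Fg|f Ff f0]; last by rewrite subr_ge0; exact: he.
    by rewrite (proj1 (P_pos x))// (proj1 nu_pos)//; ring.
  have m0 : 0 < 1 - e by lra.
  have := positive_linear_osc (resid u ur) (resid w wr) m0 _ _ Fphi osc.
  rewrite !P1 !nu1 mulr1 => /(_ erefl erefl).
  have nuW : 0 <= nu W by apply: (proj2 nu_pos).
  have : 0 <= beta * (e * nu W) by rewrite mulr_ge0 ?(ltW beta_gt0)// mulr_ge0// ltW.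
  have := ler_wpM2r S0 rho3.
  lra.
Qed.

(** A function with |f| <= W has weighted oscillation at most 1 / beta. After k contractions the
    bound is integrated against pi in the second variable, where invariance turns the iterate into
    pi f. *)
Theorem harris : exists C rho : R, 0 <= C /\ 0 <= rho < 1 /\
  forall x k f, F f -> (forall y, `|f y| <= W y) ->
  `|iter k P f x - pi f| <= C * rho ^+ k * W x.
Proof.
have [beta beta0 [rho rho01 contr]] := harris_contraction.
have [rho0 rho1] := andP rho01.
pose C := (2 + beta + beta * pi W) / beta.
have piW0 : 0 <= pi W by apply: (proj2 pi_pos).
have C0 : 0 <= C.
  by rewrite divr_ge0 ?(ltW beta0)// !addr_ge0 ?mulr_ge0 ?(ltW beta0)//.
exists C, rho; split=> //; split=> //.
have Fit f k : F f -> F (iter k P f).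
  by move=> Ff; elim: k => //= k; exact: F_P.
have piit f k : F f -> pi (iter k P f) = pi f.
  by move=> Ff; elim: k => //= k <-; rewrite piP//; exact: Fit.
have oscit f k : F f -> (forall y, `|f y| <= W y) -> forall u w,
    iter k P f u - iter k P f w <= rho ^+ k * beta^-1 * (2 + beta * W u + beta * W w).
  move=> Ff fW; elim: k => [|k IH] u w /=.
    rewrite expr0 mul1r mulrC ler_pdivlMr//.
    have : f u - f w <= W u + W w.
      have := fW u; have := fW w; rewrite !ler_norml => /andP[? ?] /andP[? ?]; lra.
    by move/(ler_wpM2r (ltW beta0)); lra.
  rewrite exprS -[rho * _ * _]mulrA; apply: contr => //; last exact: Fit.
  by rewrite mulr_ge0 ?exprn_ge0// invr_ge0 ltW.
have up f k x : F f -> (forall y, `|f y| <= W y) ->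
    iter k P f x - pi f <= C * rho ^+ k * W x.
  move=> Ff fW; pose c := rho ^+ k * beta^-1.
  have c0 : 0 <= c by rewrite mulr_ge0 ?exprn_ge0// invr_ge0 ltW.
  pose a := c * (2 + beta * W x) - iter k P f x.
  have := (proj2 pi_pos) (fun w => c * beta * W w + (iter k P f w + a)).
  have Fk := Fit f k Ff.
  rewrite (proj1 pi_pos)//; last exact: class_add.
  rewrite positive_linearD// piit// (positive_linear_cst _ pi_pos) pi1 => H.
  have {}H : 0 <= c * beta * pi W + (pi f + a * 1).
    apply: H; first by apply: F_lin => //; exact: class_add.
    by move=> w; have := oscit f k Ff fW x w; rewrite -/c /a; lra.
  apply: (@le_trans _ _ (c * (2 + beta * W x + beta * pi W))).
    by move: H; rewrite /a; lra.
  have -> : C * rho ^+ k * W x = c * ((2 + beta + beta * pi W) * W x) by rewrite /C /c; ring.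
  apply: ler_wpM2l => //.
  have : (2 + beta * pi W) * 1 <= (2 + beta * pi W) * W x.
    by apply: ler_wpM2l => //; rewrite addr_ge0// mulr_ge0// ltW.
  lra.
move=> x k f Ff fW; rewrite ler_norml; apply/andP; split; last exact: up.
(* The lower bound is the upper bound for - f. *)
have FN : F (fun y => -1 * f y) by exact: class_scale.
have itN j : iter j P (fun y => -1 * f y) = fun y => -1 * iter j P f y.
  elim: j => //= j ->; apply/funext => y.
  by rewrite (positive_linearZ _ (P_pos y))//; exact: Fit.
have := up (fun y => -1 * f y) k x FN _.
rewrite itN (positive_linearZ _ pi_pos)// => H.
have : -1 * iter k P f x - -1 * pi f <= C * rho ^+ k * W x.
  by apply: H => y; rewrite mulN1r normrN.
lra.
Qed.
End harris.

(** * Metropolis-Hastings operators *)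

Section metropolis.
Context (R : realType) (dT : measure_display) (T : measurableType dT)
  (mu : {sigma_finite_measure set T -> \bar R}).
Variables (k : T -> T -> R) (p W : T -> R).
Implicit Types (f g : T -> R) (x y : T).
Hypothesis mk : measurable_fun [set: T * T] (fun z => k z.1 z.2).
Hypothesis k_ge0 : forall x y, 0 <= k x y.
Hypothesis mp : measurable_fun [set: T] p.
Hypothesis p_ge0 : forall x, 0 <= p x.
Hypothesis reversible : forall x y, p x * k x y = p y * k y x.
Hypothesis mW : measurable_fun [set: T] W.
Hypothesis W_ge1 : forall x, 1 <= W x.
Hypothesis Wk_integrable : forall x, mu.-integrable setT (fun y => (W y * k x y)%:E).
Hypothesis Wp_integrable : mu.-integrable setT (fun y => (W y * p y)%:E).
Hypothesis k_le1 : forall x, \int[mu]_y k x y <= 1.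

(** The class on which Harris' theorem is run: its members are integrable against each k x and
    against p, so that the integrals act linearly. *)
Definition Wbounded (f : T -> R) : Prop :=
  measurable_fun setT f /\ exists c, forall x, `|f x| <= c * W x.

Definition metropolis_op (f : T -> R) (x : T) : R :=
  \int[mu]_y (f y * k x y) + f x * (1 - \int[mu]_y k x y).

Lemma dominating_ge0 x : 0 <= W x. Proof. exact: le_trans (W_ge1 x). Qed.

Lemma Wbounded_lin a f g : Wbounded f -> Wbounded g -> Wbounded (fun x => a * f x + g x).
Proof.
move=> [mf [c fc]] [mg [e ge]]; split.
  by apply: measurable_funD => //; exact: measurable_funM.
exists (`|a| * c + e) => x; apply: le_trans (ler_normD _ _) _.
by rewrite normrM mulrDl -mulrA lerD// ler_wpM2l.
Qed.

Lemma Wbounded_cst c : Wbounded (fun=> c).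
Proof.
split; first exact: measurable_cst.
by exists `|c| => x; rewrite ler_peMr.
Qed.

Lemma Wbounded_W : Wbounded W.
Proof. by split=> //; exists 1 => x; rewrite mul1r ger0_norm ?dominating_ge0. Qed.

Section weight.
Variable w : T -> R.
Hypothesis mw : measurable_fun setT w.
Hypothesis w_ge0 : forall x, 0 <= w x.
Hypothesis Ww : mu.-integrable setT (fun y => (W y * w y)%:E).

Lemma integrable_weight f : Wbounded f -> mu.-integrable setT (fun y => (f y * w y)%:E).
Proof.
move=> [mf [c fc]]; apply: (@le_integrable _ _ _ mu setT measurableT _ (fun y => c%:E * (W y * w y)%:E)%E).
- by apply/measurable_EFinP; exact: measurable_funM.
- move=> y _; rewrite -EFinM /= lee_fin normrM (ger0_norm (w_ge0 y)).
  apply: le_trans (ler_norm _); rewrite mulrA ler_wpM2r//.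
- exact: integrableZl.
Qed.

Lemma positive_linear_weight : positive_linear Wbounded (fun f => \int[mu]_y (f y * w y)).
Proof.
split=> [a f g Ff Fg|f Ff f0]; last by apply: Rintegral_ge0 => y _; exact: mulr_ge0.
have fi := integrable_weight Ff; have gi := integrable_weight Fg.
rewrite -RintegralZl// -RintegralD//; last exact: (integrableZl _ a fi).
by apply: eq_Rintegral => y _; rewrite mulrDl mulrA.
Qed.

End weight.

Lemma measurable_kernel_row x : measurable_fun setT (k x).
Proof. exact: (measurableT_comp mk (pair1_measurable x)). Qed.

Lemma positive_linear_kernel x : positive_linear Wbounded (fun f => \int[mu]_y (f y * k x y)).
Proof. exact: positive_linear_weight (measurable_kernel_row x) (k_ge0 x) (Wk_integrable x). Qed.

Lemma kernel_mass_ge0 x : 0 <= \int[mu]_y k x y.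
Proof. by apply: Rintegral_ge0 => y _. Qed.

Lemma kernel_integrable x f : Wbounded f -> mu.-integrable setT (fun y => (f y * k x y)%:E).
Proof. exact: integrable_weight (measurable_kernel_row x) (k_ge0 x) (Wk_integrable x) f. Qed.

Lemma metropolis_pos x : positive_linear Wbounded (metropolis_op^~ x).
Proof.
have [kl kp] := positive_linear_kernel x; split=> [a f g Ff Fg|f Ff f0].
  by rewrite /metropolis_op kl//; ring.
by rewrite addr_ge0 ?kp// mulr_ge0// subr_ge0.
Qed.

Lemma metropolis1 x : metropolis_op (fun=> 1) x = 1.
Proof.
rewrite /metropolis_op mul1r.
under eq_Rintegral do rewrite mul1r.
by rewrite addrC subrK.
Qed.

(** Positive and negative parts are treated separately by Tonelli, as f has no sign. *)
Lemma measurable_kernel_integral f : measurable_fun setT f ->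
  measurable_fun setT (fun x => \int[mu]_y (f y * k x y)).
Proof.
move=> mf; apply: (measurableT_comp (@fine_measurable R setT measurableT)).
pose h (z : T * T) := (f z.2 * k z.1 z.2)%:E.
have mh : measurable_fun setT h.
  apply/measurable_EFinP; apply: measurable_funM => //.
  exact: (measurableT_comp mf measurable_snd).
under eq_fun do rewrite integralE.
apply: emeasurable_funB.
  rewrite [X in measurable_fun _ X](_ : _ = fubini_F mu h^\+%E).
    by apply: measurable_fun_fubini_tonelli_F => //; exact: measurable_funepos.
  by apply/funext => x; apply: eq_integral => y _; rewrite !funeposE.
rewrite [X in measurable_fun _ X](_ : _ = fubini_F mu h^\-%E).
  by apply: measurable_fun_fubini_tonelli_F => //; exact: measurable_funeneg.
by apply/funext => x; apply: eq_integral => y _; rewrite !funenegE.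
Qed.

Lemma measurable_kernel_mass : measurable_fun setT (fun x => \int[mu]_y k x y).
Proof.
have := measurable_kernel_integral (@measurable_cst _ _ T R setT 1).
by congr measurable_fun; apply/funext => x; apply: eq_Rintegral => y _; rewrite mul1r.
Qed.

Lemma measurable_metropolis f : measurable_fun setT f -> measurable_fun setT (metropolis_op f).
Proof.
move=> mf; apply: measurable_funD; first exact: measurable_kernel_integral.
apply: measurable_funM => //; apply: measurable_funB => //; exact: measurable_kernel_mass.
Qed.

Lemma kernel_mass_EFin x : (\int[mu]_y (k x y)%:E = (\int[mu]_y k x y)%:E)%E.
Proof.
rewrite /Rintegral fineK//; apply: integrable_fin_num => //.
have := kernel_integrable x (Wbounded_cst 1).
by under eq_fun do rewrite mul1r.
Qed.

Lemma kernel_integral_EFin x f : Wbounded f ->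
  (\int[mu]_y (f y * k x y)%:E = (\int[mu]_y (f y * k x y))%:E)%E.
Proof. by move=> Ff; rewrite /Rintegral fineK//; apply: integrable_fin_num => //; exact: kernel_integrable. Qed.

(** Tonelli and detailed balance show that the accepted part contributes the integral of f p m, m
    being the accepted mass; this is what the rejection term is short of. *)
Lemma metropolis_invariant_ge0 f : Wbounded f -> (forall x, 0 <= f x) ->
  \int[mu]_x (metropolis_op f x * p x) = \int[mu]_x (f x * p x).
Proof.
move=> Ff f0; have mf := Ff.1.
have fp : mu.-integrable setT (fun y => (f y * p y)%:E) by exact: integrable_weight.
pose K f x := \int[mu]_y (f y * k x y).
pose m x := \int[mu]_y k x y.
have K0 x : 0 <= K f x by apply: Rintegral_ge0 => y _; exact: mulr_ge0.
have fpm : mu.-integrable setT (fun x => (f x * p x * m x)%:E).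
  apply: (le_integrable measurableT _ _ fp) => /=.
    apply/measurable_EFinP; apply: measurable_funM; last exact: measurable_kernel_mass.
    exact: measurable_funM.
  move=> x _; rewrite lee_fin normrM (ger0_norm (kernel_mass_ge0 x)).
  by rewrite ler_piMr// k_le1.
have swap : (\int[mu]_x (K f x * p x)%:E = \int[mu]_x (f x * p x * m x)%:E)%E.
  transitivity (\int[mu]_x \int[mu]_y (f y * k x y * p x)%:E)%E.
    apply: eq_integral => x _; rewrite EFinM -kernel_integral_EFin//.
    rewrite -ge0_integralZr//.
    - by apply/measurable_EFinP; apply: measurable_funM => //; exact: measurable_kernel_row.
    - by move=> y _; rewrite lee_fin mulr_ge0.
    - by rewrite lee_fin.
  rewrite (@fubini_tonelli _ _ _ _ _ mu mu (fun z => (f z.2 * k z.1 z.2 * p z.1)%:E)); last 2 first.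
  - apply/measurable_EFinP; apply: measurable_funM.
      by apply: measurable_funM => //; exact: (measurableT_comp mf measurable_snd).
    exact: (measurableT_comp mp measurable_fst).
  - by move=> z; rewrite lee_fin !mulr_ge0.
  apply: eq_integral => y _ /=.
  rewrite EFinM -kernel_mass_EFin -ge0_integralZl//.
  - by apply: eq_integral => x _; rewrite -EFinM -!mulrA [k x y * _]mulrC reversible.
  - by apply/measurable_EFinP; exact: measurable_kernel_row.
  - by move=> x _; rewrite lee_fin.
  - by rewrite lee_fin mulr_ge0.
(* Finiteness is read off from [swap], whose right side is dominated by f p. *)
have Kp : mu.-integrable setT (fun x => (K f x * p x)%:E).
  apply/integrableP; split.
    by apply/measurable_EFinP; apply: measurable_funM => //; exact: measurable_kernel_integral.
  under eq_integral do rewrite gee0_abs ?lee_fin ?mulr_ge0//.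
  rewrite swap; move/integrableP: fpm => [_].
  by under eq_integral do rewrite gee0_abs ?lee_fin ?mulr_ge0 ?kernel_mass_ge0//.
transitivity (\int[mu]_x (K f x * p x + (f x * p x - f x * p x * m x))).
  apply: eq_Rintegral => x _; rewrite /metropolis_op -/(K f x) -/(m x); ring.
rewrite RintegralD//; last exact: (integrableB measurableT fp fpm).
rewrite RintegralB//.
have -> : \int[mu]_x (K f x * p x) = \int[mu]_x (f x * p x * m x) by rewrite /Rintegral swap.
by rewrite addrC subrK.
Qed.

Hypothesis p_mass1 : \int[mu]_x p x = 1.
Variables (lambda b : R) (nu : (T -> R) -> R).
Hypothesis lambda_bnd : 0 <= lambda < 1.
Hypothesis b_gt0 : 0 < b.
Hypothesis drift : forall x, metropolis_op W x <= lambda * W x + b.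
Hypothesis nu_pos : positive_linear Wbounded nu.
Hypothesis nu1 : nu (fun=> 1) = 1.
Hypothesis minor : forall r, exists2 e, 0 < e & forall x f, W x <= r ->
  Wbounded f -> (forall y, 0 <= f y) -> e * nu f <= metropolis_op f x.

(** Positivity at |c| W + f and |c| W - f bounds the image of f by |c| times the image of W, and the
    drift bounds the latter by (lambda + b) W. *)
Lemma Wbounded_metropolis f : Wbounded f -> Wbounded (metropolis_op f).
Proof.
move=> Ff; have [mf [c fc]] := Ff; split; first exact: measurable_metropolis.
exists (`|c| * (lambda + b)) => x.
have fc' y : `|f y| <= `|c| * W y.
  by apply: le_trans (fc y) _; rewrite ler_wpM2r ?dominating_ge0// ler_norm.
have PW : metropolis_op W x <= (lambda + b) * W x.
  apply: le_trans (drift x) _; rewrite mulrDl lerD2l ler_peMr ?(ltW b_gt0)//.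
have Fdom a : Wbounded (fun y => `|c| * W y + a * f y).
  apply: Wbounded_lin; first exact: Wbounded_W.
  have := Wbounded_lin a Ff (Wbounded_cst 0).
  by under eq_fun do rewrite addr0.
have P := metropolis_pos x.
have dom a : `|a| <= 1 -> 0 <= `|c| * metropolis_op W x + a * metropolis_op f x.
  move=> a1.
  have := P.2 _ (Fdom a).
  have Faf : Wbounded (fun y => a * f y).
    by apply: (class_scale Wbounded_lin Wbounded_cst).
  rewrite P.1//; last exact: Wbounded_W.
  have /= -> := positive_linearZ Wbounded_cst a P Ff; apply => y.
  have : `|a * f y| <= `|c| * W y.
    by rewrite normrM; apply: le_trans (fc' y); rewrite ler_piMl.
  by rewrite ler_norml; lra.
have h1 := dom 1; rewrite normr1 lexx in h1; have {}h1 := h1 isT.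
have h2 := dom (-1); rewrite normrN1 lexx in h2; have {}h2 := h2 isT.
rewrite -mulrA; apply: (@le_trans _ _ (`|c| * metropolis_op W x)).
  rewrite ler_norml; apply/andP; split; lra.
by rewrite ler_wpM2l.
Qed.

(** f = (c W + f) - c W is a difference of nonnegative members of the class, so Tonelli is
    enough. *)
Lemma metropolis_invariant f : Wbounded f ->
  \int[mu]_x (metropolis_op f x * p x) = \int[mu]_x (f x * p x).
Proof.
move=> Ff; have [mf [c fc]] := Ff.
have [pil _] := positive_linear_weight mp p_ge0 Wp_integrable.
have fWE : f = fun y => - c * W y + (c * W y + f y).
  by apply/funext => y; rewrite mulNr addKr.
have FcW : Wbounded (fun y => c * W y + f y) by apply: Wbounded_lin => //; exact: Wbounded_W.
have PE : metropolis_op f = fun x => - c * metropolis_op W x +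
    metropolis_op (fun y => c * W y + f y) x.
  apply/funext => x; rewrite {1}fWE; have [Pl _] := metropolis_pos x.
  exact: Pl (Wbounded_W) FcW.
rewrite PE pil; [|exact/Wbounded_metropolis/Wbounded_W|exact: Wbounded_metropolis].
rewrite !metropolis_invariant_ge0//; last 3 first.
- by move=> y; have := fc y; rewrite ler_norml; lra.
- exact: Wbounded_W.
- exact: dominating_ge0.
by rewrite [in RHS]fWE (pil _ _ _ Wbounded_W FcW).
Qed.

Theorem metropolis_geometric : exists C rho : R, 0 <= C /\ 0 <= rho < 1 /\
  forall x n f, Wbounded f -> (forall y, `|f y| <= W y) ->
  `|iter n metropolis_op f x - \int[mu]_y (f y * p y)| <= C * rho ^+ n * W x.
Proof.
apply: (@harris R T Wbounded Wbounded_lin Wbounded_cst W Wbounded_W W_ge1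
  metropolis_op nu _ Wbounded_metropolis metropolis_pos metropolis1 nu_pos nu1
  (positive_linear_weight mp p_ge0 Wp_integrable) _ metropolis_invariant lambda b) => //.
by under eq_Rintegral do rewrite mul1r.
Qed.

End metropolis.

(** * Lebesgue measure on R^d *)

Section lebesgue_tuple.
Variable R : realType.

Lemma measurable_cons_pair n :
  measurable_fun [set: measurableTypeR R * n.-tuple R] (fun z => [the n.+1.-tuple R of z.1 :: z.2]).
Proof. exact: measurable_cons. Qed.

(* [lebesgue_measure] is a measure on [measurableTypeR R], whose display differs
   from that of the canonical structure on [R] used in [n.-tuple R]. *)
Section cons_measure.
Variables (leb : {sigma_finite_measure set (measurableTypeR R) -> \bar R}) (n : nat) (mu : {sigma_finite_measure set (n.-tuple R) -> \bar R}).

Let consp (z : measurableTypeR R * n.-tuple R) : n.+1.-tuple R := [the n.+1.-tuple R of z.1 :: z.2].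
Let mconsp : measurable_fun setT consp := @measurable_cons_pair n.

Definition cons_measure : set (n.+1.-tuple R) -> \bar R := pushforward (leb \x mu)%E consp.

Let cons_measure0 : cons_measure set0 = 0%E.
Proof. exact: measure0. Qed.

Let cons_measure_ge0 A : (0 <= cons_measure A)%E.
Proof. exact: measure_ge0. Qed.

Let cons_measure_sigma_additive : semi_sigma_additive cons_measure.
Proof. exact: measure_semi_sigma_additive. Qed.

HB.instance Definition _ := isMeasure.Build _ _ _ cons_measure
  cons_measure0 cons_measure_ge0 cons_measure_sigma_additive.

Lemma cons_measure_sigma_finite : sigma_finite setT cons_measure.
Proof.
have /sigma_finiteP[F [FT ndF Ffin]] := sigma_finiteT leb.
have /sigma_finiteP[G [GT ndG Gfin]] := sigma_finiteT mu.
pose unc (s : n.+1.-tuple R) : measurableTypeR R * n.-tuple R := (thead s, [tuple of behead s]).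
have munc : measurable_fun setT unc.
  apply: measurable_fun_pair; last exact: measurable_behead.
  exact: measurable_tnth.
have consK z : unc (consp z) = z.
  by case: z => t s; rewrite /unc /consp theadE; congr (_, _); apply: val_inj.
exists (fun k => unc @^-1` (F k `*` G k)).
  apply/seteqP; split=> // s _.
  have [i _ Fi] : (\bigcup_i F i) (unc s).1 by rewrite -FT.
  have [j _ Gj] : (\bigcup_i G i) (unc s).2 by rewrite -GT.
  (* The two exhausting sequences are nondecreasing, so one index serves both factors. *)
  exists (maxn i j) => //; split.
    by move: (unc s).1 Fi; exact/subsetPset/ndF/leq_maxl.
  by move: (unc s).2 Gj; exact/subsetPset/ndG/leq_maxr.
move=> k; have [mF Fk] := Ffin k; have [mG Gk] := Gfin k; split.
  by rewrite -[X in measurable X]setTI; apply: munc => //; exact: measurableX.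
rewrite /cons_measure /pushforward -comp_preimage.
rewrite (_ : unc \o consp = id); last by apply/funext => z /=; rewrite consK.
by rewrite preimage_id product_measure1E// lte_mul_pinfty// ge0_fin_numE.
Qed.

HB.instance Definition _ := Measure_isSigmaFinite.Build _ _ _ cons_measure cons_measure_sigma_finite.

Definition lebesgue_cons : {sigma_finite_measure set (n.+1.-tuple R) -> \bar R} := cons_measure.

Lemma integral_lebesgue_cons (f : n.+1.-tuple R -> \bar R) :
  measurable_fun setT f -> (forall x, (0 <= f x)%E) ->
  (\int[lebesgue_cons]_x f x = \int[leb]_t \int[mu]_s f [tuple of t :: s])%E.
Proof.
move=> mf f0; rewrite ge0_integral_pushforward//= preimage_setT.
rewrite fubini_tonelli1//=; exact: measurableT_comp.
Qed.

End cons_measure.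

(** Gives access to the theory of integration for a measure on tuples; only this identity is used of
    the measure. *)
Lemma tint_measure n : exists mu : {sigma_finite_measure set (n.-tuple R) -> \bar R},
  forall f, measurable_fun setT f -> (forall x, (0 <= f x)%E) ->
  tint f = (\int[mu]_x f x)%E.
Proof.
elim: n => [|n [mu IH]].
  exists (dirac [tuple]) => f mf f0 /=.
  by rewrite integral_dirac//= diracT mul1e.
exists (lebesgue_cons (@lebesgue_measure R) mu) => f mf f0.
rewrite integral_lebesgue_cons//=; apply: eq_integral => t _; apply: IH => //.
apply: measurableT_comp => //.
exact: measurable_cons.
Qed.

End lebesgue_tuple.

(** * Measurability of continuous functions on R^d *)

Section vcontinuous_measurable.
Variables (R : realType) (d : nat).
Notation Rd := (d.-tuple R).

(** g is the pointwise limit of functions constant on grid cells of side 1 / (n + 1). There are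
    countably many cells, each a finite intersection of strips, hence measurable for the product
    sigma-algebra. *)
Lemma vcontinuous_measurable (g : Rd -> R) : vcontinuous g -> measurable_fun setT g.
Proof.
move=> cg.
pose grid (n : nat) (k : d.-tuple int) : Rd := [tuple (tnth k i)%:~R / n.+1%:R | i < d].
pose cell (n : nat) (x : Rd) : d.-tuple int := [tuple Num.floor (tnth x i * n.+1%:R) | i < d].
apply: (@measurable_fun_cvg _ _ _ _ (fun n x => g (grid n (cell n x)))).
  move=> n _ Y mY; rewrite setTI.
  have -> : (fun x => g (grid n (cell n x))) @^-1` Y =
    \bigcup_(k : d.-tuple int) (if pselect (Y (g (grid n k)))
       then \bigcap_(i : 'I_d) [set x : Rd | Num.floor (tnth x i * n.+1%:R) = tnth k i] else set0).
    apply/seteqP; split=> [x /= Yx|x [k _]].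
      exists (cell n x) => //; case: pselect => // _ i _ /=.
      by rewrite tnth_mktuple.
    case: pselect => // Yk xk /=.
    suff -> : cell n x = k by [].
    by apply: eq_from_tnth => i; rewrite tnth_mktuple; exact: xk.
  apply: countable_bigcupT_measurable => // k.
  case: pselect => /= ?//; apply: fin_bigcap_measurable => [//|i _].
  have -> : [set x : Rd | Num.floor (tnth x i * n.+1%:R) = tnth k i] =
    (@tnth _ R ^~ i) @^-1` `[(tnth k i)%:~R / n.+1%:R, (tnth k i + 1)%:~R / n.+1%:R[.
    apply/seteqP; split=> x /=; rewrite in_itv/= ler_pdivrMr// ltr_pdivlMr//.
      by move=> /eqP; rewrite floor_eq.
    by rewrite -floor_eq => /eqP.
  rewrite -[X in measurable X]setTI; apply: (@measurable_tnth _ R d i measurableT).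
  exact: measurable_itv.
move=> x _; apply/cvgrPdist_lt => e e0.
have [del del0 hdel] := cg x e e0.
near=> n.
rewrite distrC; apply: hdel.
apply: le_lt_trans (vnorm_le_sum _) _.
have n0 : 0 < n.+1%:R :> R by [].
apply: (@le_lt_trans _ _ (\sum_(i < d) n.+1%:R^-1)).
  apply: ler_sum => i _; rewrite !tnthE !tnth_mktuple.
  have := floor_itv (tnth x i * n.+1%:R); rewrite intrD => /andP[h1 h2].
  rewrite -(ler_pM2r n0) mulVf ?gt_eqF// //.
  have nE (u : R) : `|u| * n.+1%:R = `|u * n.+1%:R| by rewrite normrM (gtr0_norm n0).
  rewrite nE mulrBl divfK ?gt_eqF// ler_norml; apply/andP; split; lra.
rewrite sumr_const card_ord -(mulr_natl _ d) ltr_pdivrMr//.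
rewrite -ltr_pdivrMl//.
near: n; exists (Num.truncn (del^-1 * d%:R)).+1 => // n /= hn.
apply: lt_le_trans (truncnS_gt _) _.
by rewrite ler_nat ltnW.
Unshelve. all: by end_near.
Qed.

End vcontinuous_measurable.

(** * Product integrals and one-dimensional exponential integrals *)

Section product_integral.
Variable R : realType.
Local Notation leb := (@lebesgue_measure R).

Lemma tint_prod n (g : 'I_n -> R -> R) (c : 'I_n -> R) :
  (forall i, measurable_fun setT (g i)) -> (forall i t, 0 <= g i t) ->
  (forall i, (\int[leb]_t (g i t)%:E = (c i)%:E)%E) ->
  tint (fun x : n.-tuple R => (\prod_(i < n) g i (tnth x i))%:E) = (\prod_(i < n) c i)%:E.
Proof.
elim: n g c => [|n IH] g c mg g0 gc; first by rewrite /= !big_ord0.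
have [mu muE] := tint_measure R n.
have mP : measurable_fun setT (fun s : n.-tuple R => \prod_(i < n) g (lift ord0 i) (tnth s i)).
  apply: measurable_prod => i _.
  exact: (measurableT_comp (mg _) (measurable_tnth _)).
have P0 (s : n.-tuple R) : 0 <= \prod_(i < n) g (lift ord0 i) (tnth s i) by apply: prodr_ge0.
have mg0 : measurable_fun setT (fun t => (g ord0 t)%:E) by exact/measurable_EFinP.
rewrite /= big_ord_recl EFinM -gc -ge0_integralZr//=.
- apply: eq_integral => t _.
  under [X in tint X]eq_fun => s.
    rewrite big_ord_recl tnth0.
    under eq_bigr do rewrite tnthS.
    over.
  rewrite muE; last 2 first.
  - apply/measurable_EFinP; exact: measurable_funM.
  - by move=> s; rewrite lee_fin mulr_ge0.
  under eq_integral do rewrite EFinM.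
  rewrite ge0_integralZl_EFin//; [|by move=> s _; rewrite lee_fin|exact/measurable_EFinP].
  congr (_ * _)%E; rewrite -muE.
  + exact: (IH (fun i => g (lift ord0 i)) (fun i => c (lift ord0 i))).
  + exact/measurable_EFinP.
  + by move=> s; rewrite lee_fin.
- by move=> t _; rewrite lee_fin.
- rewrite lee_fin; apply: prodr_ge0 => i _.
  by rewrite -lee_fin -gc integral_ge0// => t _; rewrite lee_fin.
Qed.

(** Completing the square: the tilted density is a constant times the normal density with mean m + a
    s^2. *)
Lemma integral_exp_normal (a m s : R) : s != 0 ->
  (\int[leb]_t (expR (a * (t - m)) * normal_pdf m s t)%:E = (expR (a ^+ 2 * s ^+ 2 / 2))%:E)%E.
Proof.
move=> s0.
have E t : expR (a * (t - m)) * normal_pdf m s t =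
    expR (a ^+ 2 * s ^+ 2 / 2) * normal_pdf (m + a * s ^+ 2) s t.
  rewrite !normal_pdfE//= !(mulrCA (expR _)) /normal_fun -!expRD; congr (_ * expR _).
  by field.
under eq_integral do rewrite E EFinM.
rewrite ge0_integralZl_EFin//=.
- by rewrite integral_normal_pdf mule1.
- by move=> t _; rewrite lee_fin normal_pdf_ge0.
- by apply/measurable_EFinP; exact: measurable_normal_pdf.
Qed.

(** On each half-line the integrand is 1 / a times an exponential density, reflected on the negative
    side. *)
Lemma integral_exp_abs_lty (a : R) : 0 < a ->
  (\int[leb]_t (expR (- (a * `|t|)))%:E < +oo)%E.
Proof.
move=> a0.
pose e := exponential_pdf a.
have me : measurable_fun setT e by exact: measurable_exponential_pdf.
have e0 t : 0 <= e t by apply: exponential_pdf_ge0; exact: ltW.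
have meN : measurable_fun setT (fun t : R => e (- t)) by exact: measurableT_comp.
have eN : (\int[leb]_t (e (- t))%:E = 1)%E.
  rewrite -(integral_exponential_pdf a0).
  transitivity (\int[pushforward leb (-%R : _ -> measurableTypeR R)]_t (e t)%:E)%E.
    rewrite ge0_integral_pushforward//=; last first.
    - by move=> y _; rewrite lee_fin.
    - exact/measurable_EFinP.
  by apply: eq_measure_integral => //= A mA _; exact: lebesgue_measureN.
apply: (@le_lt_trans _ _ (\int[leb]_t (a^-1 * (e t + e (- t)))%:E)%E).
  apply: ge0_le_integral => //=.
  - apply/measurable_EFinP; apply: measurableT_comp => //; apply: measurableT_comp => //.
    by apply: measurable_funM => //; exact: measurableT_comp.
  - by apply/measurable_EFinP; apply: measurable_funM => //; exact: measurable_funD.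
  - move=> t _; rewrite lee_fin ler_pdivlMl//.
    have [t0|t0] := lerP 0 t.
      rewrite ger0_norm// {1}/e exponential_pdfE// mulNr lerDl; exact: e0.
    rewrite ltr0_norm// {2}/e exponential_pdfE; last by rewrite oppr_ge0 ltW.
    rewrite mulNr lerDr; exact: e0.
under eq_integral do rewrite EFinM EFinD.
rewrite ge0_integralZl_EFin//=; last 3 first.
- by move=> t _; rewrite -EFinD lee_fin addr_ge0.
- by apply: emeasurable_funD; exact/measurable_EFinP.
- by rewrite invr_ge0 ltW.
rewrite ge0_integralD//=.
- by rewrite eN integral_exponential_pdf// -EFinD -EFinM ltry.
- by move=> t _; rewrite lee_fin.
- exact/measurable_EFinP.
- by move=> t _; rewrite lee_fin.
- exact/measurable_EFinP.
Qed.

End product_integral.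

(** * Gaussian proposals *)

Section rn_integral.
Variables (R : realType) (n : nat).
Notation Rn := (n.-tuple R).
Variable mu : {sigma_finite_measure set Rn -> \bar R}.
Hypothesis muE : forall f : Rn -> \bar R, measurable_fun setT f ->
  (forall x, (0 <= f x)%E) -> tint f = (\int[mu]_x f x)%E.

(** Integrability makes both halves finite; [fine] would send an infinite one to 0. *)
Lemma RintE (f : Rn -> R) : mu.-integrable setT (fun x => (f x)%:E) -> Defs.Rint f = \int[mu]_x f x.
Proof.
move=> fi; have /measurable_EFinP mf := measurable_int _ fi.
have Ep : tint (fun x => (Num.max (f x) 0)%:E) = (\int[mu]_x (EFin \o f)^\+ x)%E.
  rewrite muE.
  - by apply: eq_integral => x _; rewrite funeposE /= EFin_max.
  - by apply/measurable_EFinP; exact: measurable_maxr.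
  - by move=> x; rewrite lee_fin le_max lexx orbT.
have En : tint (fun x => (Num.max (- f x) 0)%:E) = (\int[mu]_x (EFin \o f)^\- x)%E.
  rewrite muE.
  - by apply: eq_integral => x _; rewrite funenegE /= EFin_max.
  - apply/measurable_EFinP; apply: measurable_maxr => //; exact: measurableT_comp.
  - by move=> x; rewrite lee_fin le_max lexx orbT.
rewrite /Defs.Rint Ep En /Rintegral [in RHS]integralE -fineB//.
- exact: (integrable_pos_fin_num measurableT fi).
- exact: (integrable_neg_fin_num measurableT fi).
Qed.

Section product.
Variables (g : 'I_n -> R -> R) (c : 'I_n -> R).
Hypothesis mg : forall i, measurable_fun setT (g i).
Hypothesis g_ge0 : forall i t, 0 <= g i t.
Hypothesis gc : forall i, (\int[@lebesgue_measure R]_t (g i t)%:E = (c i)%:E)%E.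

Lemma measurable_prod_coord : measurable_fun setT (fun x : Rn => \prod_(i < n) g i (tnth x i)).
Proof.
by apply: measurable_prod => i _; exact: (measurableT_comp (mg i) (measurable_tnth i)).
Qed.

Lemma integral_prod_coord : (\int[mu]_x (\prod_(i < n) g i (tnth x i))%:E = (\prod_(i < n) c i)%:E)%E.
Proof.
rewrite -muE; first exact: tint_prod.
- by apply/measurable_EFinP; exact: measurable_prod_coord.
- by move=> x; rewrite lee_fin; apply: prodr_ge0.
Qed.

Lemma integrable_prod_coord : mu.-integrable setT (fun x => (\prod_(i < n) g i (tnth x i))%:E).
Proof.
apply/integrableP; split; first by apply/measurable_EFinP; exact: measurable_prod_coord.
under eq_integral do rewrite gee0_abs ?lee_fin ?prodr_ge0//.
by rewrite integral_prod_coord ltry.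
Qed.

Lemma Rintegral_prod_coord : \int[mu]_x (\prod_(i < n) g i (tnth x i)) = \prod_(i < n) c i.
Proof. by rewrite /Rintegral integral_prod_coord. Qed.

End product.

(** The indicator of a cube, as a product so that the product formula integrates it. It is the
    minorant in all lower bounds of integrals below. *)
Definition box (m x : Rn) : R := \prod_(i < n) \1_(`[tnth m i - 1, tnth m i + 1]) (tnth x i).

Lemma box_ge0 m x : 0 <= box m x.
Proof. by apply: prodr_ge0. Qed.

Let mbox1 (m : Rn) i : measurable_fun setT (\1_(`[tnth m i - 1, tnth m i + 1]) : R -> R).
Proof. by apply: measurable_indic; exact: measurable_itv. Qed.

Let ibox1 (m : Rn) i : (\int[@lebesgue_measure R]_t (\1_(`[tnth m i - 1, tnth m i + 1]) t)%:E = 2%:E)%E.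
Proof.
rewrite integral_indic//= setIT lebesgue_measure_itv/= lte_fin ifT; last by lra.
by rewrite -EFinD; congr (_%:E); ring.
Qed.

Lemma measurable_box m : measurable_fun setT (box m).
Proof. exact: measurable_prod_coord (mbox1 m). Qed.

Lemma integrable_box m : mu.-integrable setT (fun x => (box m x)%:E).
Proof. exact: integrable_prod_coord (mbox1 m) _ (ibox1 m). Qed.

Lemma Rintegral_box m : \int[mu]_x box m x = 2 ^+ n.
Proof.
by rewrite (Rintegral_prod_coord (mbox1 m) _ (ibox1 m))// prodr_const card_ord.
Qed.

Lemma box_neq0_near m x : box m x != 0 -> vnorm (vadd x (vopp m)) <= n%:R.
Proof.
move=> bx; apply: le_trans (vnorm_le_sum _) _.
apply: (@le_trans _ _ (\sum_(i < n) (1 : R))); last by rewrite sumr_const card_ord.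
apply: ler_sum => i _; rewrite tnth_vadd tnth_vopp.
have : \1_(`[tnth m i - 1, tnth m i + 1]) (tnth x i) != 0 :> R.
  by apply: contraNN bx => /eqP h; rewrite /box (bigD1 i)//= h mul0r.
rewrite indicE mem_setE in_itv/=; case: (boolP (_ && _)); last by rewrite eqxx.
by move=> /andP[h1 h2] _; rewrite ler_norml; apply/andP; split; lra.
Qed.

Lemma box_le1 m x : box m x <= 1.
Proof.
apply: prodr_ile1 => i _; rewrite indicE.
by case: (_ \in _); rewrite ?lexx ler01.
Qed.

End rn_integral.

(** * The Gaussian proposal of MALA and its exponential moments *)

Section kernel.
Variables (R : realType) (d : nat) (U : d.-tuple R -> R) (L gam eta : R).
Notation Rd := (d.-tuple R).
Implicit Types (x y z v w : Rd) (s t : R).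
Hypothesis UC2 : C2 U.
Hypothesis grad0 : forall i, partial U i (origin R d) = 0.
Hypothesis L_ge0 : 0 <= L.
Hypothesis hessL : forall x y z, `|hess U x y z| <= L * vnorm y * vnorm z.
Hypothesis gam_gt0 : 0 < gam.
Hypothesis eta_gt0 : 0 < eta.

Lemma vcontinuous_potential : vcontinuous U.
Proof.
have L0 := L_ge0.
move=> x e e0.
have x0 := vnorm_ge0 x.
pose N := L * (vnorm x + 1) + 1.
have N0 : 0 < N by rewrite /N ltr_wpDl// mulr_ge0//; lra.
exists (Num.min 1 (e / N)); first by rewrite lt_min ltr01 divr_gt0.
move=> y; set v := vadd y (vopp x); rewrite lt_min => /andP[v1].
rewrite ltr_pdivlMr// => vN.
have [c /andP[c0 c1]] := MVT01 (is_derive_potential UC2 hessL v x).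
rewrite line_end line0 => ->.
have v0 := vnorm_ge0 v.
apply: le_lt_trans (normr_dot_le _ _) _; apply: le_lt_trans vN.
rewrite [leRHS]mulrC ler_wpM2r//.
apply: le_trans (grad_le UC2 L_ge0 grad0 hessL _) _.
apply: (@le_trans _ _ (L * (vnorm x + 1))); last by rewrite /N; lra.
rewrite ler_wpM2l//; apply: le_trans (vnorm_vadd _ _) _; rewrite lerD2l.
rewrite vnorm_vscale ger0_norm//; nra.
Qed.

Lemma measurable_potential : measurable_fun setT U.
Proof. exact: vcontinuous_measurable vcontinuous_potential. Qed.

Lemma measurable_partial i : measurable_fun setT (partial U i).
Proof. exact: vcontinuous_measurable (vcontinuous_partial UC2 hessL i). Qed.

Lemma measurable_vnorm : measurable_fun setT (@vnorm R d).
Proof.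
apply: (measurableT_comp (continuous_measurable_fun (@sqrt_continuous R))).
by apply: measurable_sum => i; apply: measurable_funX; exact: measurable_tnth.
Qed.

Lemma measurable_Wfun : measurable_fun setT (@Wfun R d eta).
Proof.
apply: measurableT_comp => //; apply: measurable_funM => //.
apply: (measurableT_comp (continuous_measurable_fun (@sqrt_continuous R))).
by apply: measurable_funD => //; apply: measurable_funX; exact: measurable_vnorm.
Qed.

Lemma sqrt1D_bounds (r : R) : 0 <= r -> r <= Num.sqrt (1 + r ^+ 2) <= 1 + r.
Proof.
move=> r0; apply/andP; split.
  by rewrite -[leLHS]ger0_norm// -sqrtr_sqr ler_wsqrtr// lerDr.
have r1 : 0 <= 1 + r by lra.
rewrite -[leRHS]ger0_norm// -sqrtr_sqr ler_wsqrtr//; nra.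
Qed.

Lemma Wfun_bounds x : expR (eta * vnorm x) <= Wfun eta x <= expR (eta * (1 + vnorm x)).
Proof.
have /andP[h1 h2] := sqrt1D_bounds (vnorm_ge0 x).
by rewrite !ler_expR !ler_wpM2l ?(ltW eta_gt0).
Qed.

Lemma Wfun_ge1 x : 1 <= Wfun eta x.
Proof. by rewrite -expR0 ler_expR mulr_ge0 ?(ltW eta_gt0)// sqrtr_ge0. Qed.

Definition proposal_mean x : Rd := vadd x (vscale (- gam) (grad U x)).
Definition proposal_std : R := Num.sqrt (2 * gam).

Let s := proposal_std.
Let s_gt0 : 0 < s. Proof. by rewrite sqrtr_gt0 mulr_gt0. Qed.
Let s_neq0 : s != 0. Proof. by rewrite gt_eqF. Qed.
Let s2 : s ^+ 2 = 2 * gam. Proof. by rewrite sqr_sqrtr// mulr_ge0// ltW. Qed.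

Lemma proposal_shift x y :
  vadd (vadd y (vopp x)) (vscale gam (grad U x)) = vadd y (vopp (proposal_mean x)).
Proof. by apply: eq_from_tnth => i; rewrite !tnthE; ring. Qed.

Lemma rpropE x y :
  rprop U gam x y = \prod_(i < d) normal_pdf (tnth (proposal_mean x) i) s (tnth y i).
Proof.
rewrite /rprop proposal_shift; set m := proposal_mean x.
under [RHS]eq_bigr do rewrite normal_pdfE//=.
rewrite big_split/= prodr_const card_ord /normal_fun -expR_sum; congr (_ * expR _).
  have g4 : 0 <= 4 * pi * gam :> R by rewrite !mulr_ge0 ?pi_ge0// ltW.
  rewrite /normal_peak s2 (_ : 2 * gam * pi *+ 2 = 4 * pi * gam); last by ring.
  by rewrite powRN (mulrC d%:R) powRrM powR12_sqrt// powR_mulrn ?sqrtr_ge0// exprVn.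
rewrite vnorm_sqr /dot s2 mulNr -mulrN mulr_suml; apply: eq_bigr => i _.
rewrite tnth_vadd tnth_vopp; field.
by rewrite gt_eqF.
Qed.

Lemma rprop_gt0 x y : 0 < rprop U gam x y.
Proof. by rewrite mulr_gt0 ?expR_gt0// powR_gt0// !mulr_gt0 ?pi_gt0. Qed.

(** The form of the Metropolis ratio: the normalizations of pi and of the proposal cancel. *)
Lemma expR_ratio (Z c a b e f : R) : 0 < Z -> 0 < c ->
  (expR a / Z * (c * expR b)) / (expR e / Z * (c * expR f)) = expR (a + b - e - f).
Proof.
move=> Z0 c0; rewrite !expRD !expRN.
have := expR_gt0 e; have := expR_gt0 f; have := expR_gt0 a; have := expR_gt0 b.
move: (expR a) (expR b) (expR e) (expR f) => A B E G B0 A0 G0 E0.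
by field; rewrite !gt_eqF.
Qed.

Lemma measurable_log_ratio : measurable_fun setT (fun z : Rd * Rd => log_ratio U gam z.1 z.2).
Proof.
have mU := measurable_potential.
have mx i : measurable_fun setT (fun z : Rd * Rd => tnth z.1 i).
  exact: (measurableT_comp (measurable_tnth i) measurable_fst).
have my i : measurable_fun setT (fun z : Rd * Rd => tnth z.2 i).
  exact: (measurableT_comp (measurable_tnth i) measurable_snd).
have mgx i : measurable_fun setT (fun z : Rd * Rd => tnth (grad U z.1) i).
  under eq_fun do rewrite tnth_grad.
  exact: (measurableT_comp (measurable_partial i) measurable_fst).
have mgy i : measurable_fun setT (fun z : Rd * Rd => tnth (grad U z.2) i).
  under eq_fun do rewrite tnth_grad.
  exact: (measurableT_comp (measurable_partial i) measurable_snd).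
apply: measurable_funB.
  apply: measurable_funD.
    apply: measurable_funB; first exact: (measurableT_comp mU measurable_fst).
    exact: (measurableT_comp mU measurable_snd).
  apply: measurable_funM => //; apply: measurable_sum => i.
  under eq_fun do rewrite !tnth_vadd tnth_vopp.
  apply: measurable_funM; last exact: measurable_funD.
  by apply: measurable_funD => //; exact: measurableT_comp.
apply: measurable_funM => //; apply: measurable_funB; apply: measurable_sum => i;
  exact: measurable_funM.
Qed.

Lemma measurable_rprop : measurable_fun setT (fun z : Rd * Rd => rprop U gam z.1 z.2).
Proof.
apply: measurable_funM => //; apply: measurableT_comp => //.
apply: measurable_funM => //; apply: measurableT_comp => //.
under eq_fun do rewrite vnorm_sqr.
apply: measurable_sum => i; under eq_fun do rewrite !tnth_vadd tnth_vopp tnth_vscale tnth_grad.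
suff h : measurable_fun setT (fun z : Rd * Rd => tnth z.2 i - tnth z.1 i + gam * partial U i z.1).
  exact: measurable_funM.
apply: measurable_funD.
  apply: measurable_funB; first exact: (measurableT_comp (measurable_tnth i) measurable_snd).
  exact: (measurableT_comp (measurable_tnth i) measurable_fst).
apply: measurable_funM => //; exact: (measurableT_comp (measurable_partial i) measurable_fst).
Qed.

Section integrals.
Variable mu : {sigma_finite_measure set Rd -> \bar R}.
Hypothesis muE : forall f : Rd -> \bar R, measurable_fun setT f ->
  (forall x, (0 <= f x)%E) -> tint f = (\int[mu]_x f x)%E.

Let npdf (x : Rd) i : R -> R := normal_pdf (tnth (proposal_mean x) i) s.
Let mnpdf x i : measurable_fun setT (npdf x i). Proof. exact: measurable_normal_pdf. Qed.
Let npdf_ge0 x i t : 0 <= npdf x i t. Proof. exact: normal_pdf_ge0. Qed.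
Let inpdf x i : (\int[@lebesgue_measure R]_t (npdf x i t)%:E = 1%:E)%E.
Proof. exact: integral_normal_pdf. Qed.

Lemma integrable_rprop x : mu.-integrable setT (fun y => (rprop U gam x y)%:E).
Proof.
under eq_fun do rewrite rpropE.
exact: (integrable_prod_coord muE (mnpdf x) (npdf_ge0 x) (inpdf x)).
Qed.

Lemma Rintegral_rprop x : \int[mu]_y rprop U gam x y = 1.
Proof.
under eq_Rintegral do rewrite rpropE.
by rewrite (Rintegral_prod_coord muE (mnpdf x) (npdf_ge0 x) (inpdf x)) big1.
Qed.

(** exp (eta |u|) <= exp (eta u) + exp (- eta u) replaces the absolute value by terms with explicit
    Gaussian integrals. *)
Let epdf (x : Rd) i (t : R) : R := 
  (expR (eta * (t - tnth (proposal_mean x) i)) + expR (- eta * (t - tnth (proposal_mean x) i))) * npdf x i t.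

Let mepdf x i : measurable_fun setT (epdf x i).
Proof.
apply: measurable_funM; last exact: mnpdf.
by apply: measurable_funD; apply: measurableT_comp => //; apply: measurable_funM => //;
  exact: measurable_funB.
Qed.

Let epdf_ge0 x i t : 0 <= epdf x i t.
Proof. by rewrite mulr_ge0// addr_ge0// expR_ge0. Qed.

Let c1 := 2 * expR (eta ^+ 2 * s ^+ 2 / 2).

Let iepdf x i : (\int[@lebesgue_measure R]_t (epdf x i t)%:E = c1%:E)%E.
Proof.
pose m := tnth (proposal_mean x) i.
have me a : measurable_fun setT (fun t : R => expR (a * (t - m)) * npdf x i t).
  apply: measurable_funM; last exact: mnpdf.
  by apply: measurableT_comp => //; apply: measurable_funM => //; exact: measurable_funB.
under eq_integral do rewrite /epdf mulrDl EFinD.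
rewrite ge0_integralD//=; first last.
- by apply/measurable_EFinP; exact: me.
- by move=> t _; rewrite lee_fin mulr_ge0// expR_ge0.
- by apply/measurable_EFinP; exact: me.
- by move=> t _; rewrite lee_fin mulr_ge0// expR_ge0.
rewrite !integral_exp_normal// sqrrN -EFinD; congr (_%:E).
by rewrite /c1; ring.
Qed.

Definition exp_moment : R := c1 ^+ d.

Lemma exp_moment_gt0 : 0 < exp_moment.
Proof. by rewrite exprn_gt0// mulr_gt0// expR_gt0. Qed.

Let Wr_le x y : Wfun eta y * rprop U gam x y <=
  expR (eta * (1 + vnorm (proposal_mean x))) * \prod_(i < d) epdf x i (tnth y i).
Proof.
rewrite rpropE /epdf big_split/= mulrA ler_wpM2r//; first by apply: prodr_ge0 => i _; exact: normal_pdf_ge0.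
have /andP[_ h] := Wfun_bounds y; apply: le_trans h _.
set m := proposal_mean x.
have h1 : vnorm y <= vnorm m + \sum_(i < d) `|tnth y i - tnth m i|.
  have {1}-> : y = vadd m (vadd y (vopp m)) by rewrite vadd_subK.
  apply: le_trans (vnorm_vadd _ _) _; rewrite lerD2l.
  apply: le_trans (vnorm_le_sum _) _.
  by apply: ler_sum => i _; rewrite tnth_vadd tnth_vopp.
apply: (@le_trans _ _ (expR (eta * (1 + vnorm m) + \sum_(i < d) eta * `|tnth y i - tnth m i|))).
  rewrite ler_expR -mulr_sumr -mulrDr ler_pM2l//; lra.
rewrite expRD ler_wpM2l ?expR_ge0// expR_sum; apply: ler_prod => i _.
rewrite expR_ge0/=; set u := tnth y i - _.
have [u0|u0] := lerP 0 u.
  by rewrite ger0_norm// lerDl expR_ge0.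
by rewrite ltr0_norm// mulrN -mulNr lerDr expR_ge0.
Qed.

Let epdf_integrable x := integrable_prod_coord muE (mepdf x) (epdf_ge0 x) (iepdf x).

Lemma integrable_Wrprop x : mu.-integrable setT (fun y => (Wfun eta y * rprop U gam x y)%:E).
Proof.
have mr : measurable_fun setT (rprop U gam x).
  exact: (measurableT_comp measurable_rprop (pair1_measurable x)).
apply: (le_integrable measurableT _ _ (integrableZl measurableT
  (expR (eta * (1 + vnorm (proposal_mean x)))) (epdf_integrable x))) => /=.
  by apply/measurable_EFinP; apply: measurable_funM => //; exact: measurable_Wfun.
move=> y _; rewrite lee_fin ger0_norm; last first.
  by rewrite mulr_ge0 ?(ltW (rprop_gt0 _ _))// expR_ge0.
by apply: le_trans (Wr_le x y) _; exact: ler_norm.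
Qed.

Lemma Rintegral_Wrprop x : \int[mu]_y (Wfun eta y * rprop U gam x y) <=
  expR (eta * (1 + vnorm (proposal_mean x))) * exp_moment.
Proof.
apply: (@le_trans _ _ (\int[mu]_y (expR (eta * (1 + vnorm (proposal_mean x))) *
    \prod_(i < d) epdf x i (tnth y i)))).
  apply: le_Rintegral => //; first exact: integrable_Wrprop.
  exact: (integrableZl measurableT _ (epdf_integrable x)).
rewrite RintegralZl//; last exact: epdf_integrable.
rewrite (Rintegral_prod_coord muE (mepdf x) (epdf_ge0 x) (iepdf x)).
by rewrite prodr_const card_ord.
Qed.

End integrals.
End kernel.

(** * Geometric ergodicity of MALA *)

Section mala_kernel.
Variables (R : realType) (d : nat) (U : d.-tuple R -> R) (beta L mb Lb Kb : R).
Notation Rd := (d.-tuple R).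
Implicit Types (x y z v w : Rd) (f : Rd -> R).
Hypothesis beta01 : 0 <= beta < 1.
Hypothesis UC2 : C2 U.
Hypothesis grad0 : forall i, partial U i (origin R d) = 0.
Hypothesis L_ge0 : 0 <= L.
Hypothesis hessL : forall x y z, `|hess U x y z| <= L * vnorm y * vnorm z.
Hypothesis mb_gt0 : 0 < mb.
Hypothesis Lb_ge0 : 0 <= Lb.
Hypothesis Kb_ge0 : 0 <= Kb.
Hypothesis hessB : forall x y, Kb <= vnorm x -> vnorm y = 1 ->
     hess U x y y <= Lb / (1 + vnorm x `^ (3 * beta / 4)) /\
     mb / (1 + vnorm x `^ beta) <= hess U x y y.
Variable mu : {sigma_finite_measure set Rd -> \bar R}.
Hypothesis muE : forall f : Rd -> \bar R, measurable_fun setT f ->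
  (forall x, (0 <= f x)%E) -> tint f = (\int[mu]_x f x)%E.

Lemma box_le (h : Rd -> R) m e : 0 <= e -> (forall y, 0 <= h y) ->
  (forall y, vnorm (vadd y (vopp m)) <= d%:R -> e <= h y) ->
  forall y, e * box m y <= h y.
Proof.
move=> e0 h0 he y; have [->|b0] := eqVneq (box m y) 0; first by rewrite mulr0.
apply: le_trans (he y (box_neq0_near b0)).
by rewrite -[leRHS]mulr1 ler_wpM2l// box_le1.
Qed.

Lemma measurable_gibbs : measurable_fun setT (fun y => expR (- U y)).
Proof.
apply: measurableT_comp => //; apply: measurableT_comp => //.
exact: measurable_potential UC2 grad0 L_ge0 hessL.
Qed.

Lemma integrable_Wgibbs (eta : R) : 0 < eta ->
  mu.-integrable setT (fun y => (Wfun eta y * expR (- U y))%:E).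
Proof.
move=> eta0; have eta0' := ltW eta0.
(* Slope eta pays for W; slope d leaves exp (- sum |y_i|), as the sum is at most d |y|. *)
have A0 : 0 <= eta + d%:R by rewrite addr_ge0.
have [B hB] := potential_growth beta01 UC2 grad0 L_ge0 hessL mb_gt0 hessB A0.
pose g (i : 'I_d) (t : R) := expR (- (1 * `|t|)).
pose c := fine (\int[@lebesgue_measure R]_t (expR (- (1 * `|t|)))%:E)%E.
have mg i : measurable_fun setT (g i).
  by apply: measurableT_comp => //; apply: measurableT_comp => //; apply: measurable_funM.
have g0 i t : 0 <= g i t by exact: expR_ge0.
have gc i : (\int[@lebesgue_measure R]_t (g i t)%:E = c%:E)%E.
  rewrite /c fineK// ge0_fin_numE; first exact: integral_exp_abs_lty.
  by apply: integral_ge0 => t _; rewrite lee_fin expR_ge0.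
have gi := integrable_prod_coord muE mg g0 gc.
apply: (le_integrable measurableT _ _ (integrableZl measurableT (expR (eta + B)) gi)) => /=.
  by apply/measurable_EFinP; apply: measurable_funM; [exact: measurable_Wfun|exact: measurable_gibbs].
move=> y _; rewrite lee_fin ger0_norm ?mulr_ge0 ?expR_ge0//.
apply: le_trans (ler_norm _).
have /andP[_ h] := Wfun_bounds eta0 y.
apply: (le_trans (ler_wpM2r (expR_ge0 _) h)).
rewrite -expR_sum -!expRD ler_expR sumrN.
have -> : \sum_(i < d) 1 * `|tnth y i| = \sum_(i < d) `|tnth y i|.
  by apply: eq_bigr => i _; rewrite mul1r.
have := sum_le_vnorm y; have := hB y; lra.
Qed.

Lemma integrable_gibbs : mu.-integrable setT (fun y => (expR (- U y))%:E).
Proof.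
apply: (le_integrable measurableT _ _ (integrable_Wgibbs ltr01)) => /=.
  by apply/measurable_EFinP; exact: measurable_gibbs.
move=> y _; rewrite lee_fin normrM (ger0_norm (expR_ge0 (- U y))).
by rewrite ler_peMl ?expR_ge0// ger0_norm ?expR_ge0// Wfun_ge1.
Qed.

Let Z : R := \int[mu]_y expR (- U y).

Let ZE : Defs.Rint (fun y => expR (- U y)) = Z.
Proof. exact: RintE muE _ integrable_gibbs. Qed.

(** The integrand is bounded below on a cube about the origin. *)
Lemma gibbs_mass_gt0 : 0 < Z.
Proof.
pose e := expR (- (U (origin R d) + L * d%:R ^+ 2)).
have le y : e * box (origin R d) y <= expR (- U y).
  apply: (@box_le (fun y => expR (- U y))); [exact: expR_ge0|by move=> ?; exact: expR_ge0|].
  move=> {}y; rewrite (_ : vadd y _ = y); last first.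
    by apply: eq_from_tnth => i; rewrite tnth_vadd tnth_vopp tnth_origin subr0.
  move=> yd; rewrite ler_expR lerN2.
  have := potential_le UC2 L_ge0 grad0 hessL y; rewrite ler_norml => /andP[_ h].
  have : L * vnorm y ^+ 2 <= L * d%:R ^+ 2.
    by rewrite ler_wpM2l// ler_sqr ?nnegrE ?vnorm_ge0.
  lra.
apply: (@lt_le_trans _ _ (e * 2 ^+ d)); first by rewrite mulr_gt0 ?expR_gt0// exprn_gt0.
rewrite -(Rintegral_box muE (origin R d)) -RintegralZl//; last exact: integrable_box.
apply: le_Rintegral => //; last exact: integrable_gibbs.
exact: (integrableZl measurableT e (integrable_box muE _)).
Qed.

Let Z_gt0 := gibbs_mass_gt0.

Let pidensE x : pidens U x = Z^-1 * expR (- U x).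
Proof. by rewrite /pidens ZE mulrC. Qed.

Lemma pidens_ge0 x : 0 <= pidens U x.
Proof. by rewrite pidensE mulr_ge0 ?expR_ge0// invr_ge0 ltW. Qed.

Lemma measurable_pidens : measurable_fun setT (pidens U).
Proof.
rewrite (_ : pidens U = fun x => Z^-1 * expR (- U x)); last exact/funext.
by apply: measurable_funM => //; exact: measurable_gibbs.
Qed.

Lemma integrable_Wpidens (eta : R) : 0 < eta ->
  mu.-integrable setT (fun y => (Wfun eta y * pidens U y)%:E).
Proof.
move=> /integrable_Wgibbs /(integrableZl measurableT Z^-1).
by under eq_fun do rewrite -EFinM mulrCA -pidensE.
Qed.

Lemma Rintegral_pidens : \int[mu]_y pidens U y = 1.
Proof.
under eq_Rintegral do rewrite pidensE.
rewrite RintegralZl//; last exact: integrable_gibbs.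
by rewrite mulVf// gt_eqF.
Qed.

(** * Drift and minorization for a fixed step *)

Section step.
Variables (gam eta : R).
Hypothesis gam_gt0 : 0 < gam.
Hypothesis eta_gt0 : 0 < eta.
Let W := @Wfun R d eta.

Definition mala_density x y : R := accept U gam x y * rprop U gam x y.
Let k := mala_density.

Lemma accept_log x y : accept U gam x y = Num.min 1 (expR (log_ratio U gam x y)).
Proof.
have c0 : 0 < (4 * pi * gam) `^ (- (d%:R / 2)) by rewrite powR_gt0// !mulr_gt0 ?pi_gt0.
rewrite /accept /pidens ZE; congr (Num.min 1 _).
apply: etrans (expR_ratio _ _ _ _ Z_gt0 c0) (congr1 expR _).
rewrite !vnorm_sqr /log_ratio; move: (grad U x) (grad U y) => g h.
rewrite !(dotDl, dotDr, dotNl, dotNr, dotZl, dotZr) (dotC x y) (dotC h y) (dotC h x)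
  (dotC g x) (dotC g y).
by field; rewrite gt_eqF.
Qed.

Lemma accept_ge0 x y : 0 <= accept U gam x y.
Proof. by rewrite accept_log le_min ler01 expR_ge0. Qed.

Lemma accept_le1 x y : accept U gam x y <= 1.
Proof. by rewrite accept_log ge_min lexx. Qed.

Lemma measurable_mala_density : measurable_fun setT (fun z : Rd * Rd => k z.1 z.2).
Proof.
apply: measurable_funM; last exact: measurable_rprop UC2 hessL.
under eq_fun do rewrite accept_log.
apply: measurable_minr => //; apply: measurableT_comp => //.
exact: measurable_log_ratio UC2 grad0 L_ge0 hessL.
Qed.

Lemma mala_density_ge0 x y : 0 <= k x y.
Proof. by rewrite mulr_ge0 ?accept_ge0// ltW// rprop_gt0. Qed.

Lemma mala_density_le x y : k x y <= rprop U gam x y.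
Proof. by rewrite ler_piMl ?accept_le1// ltW// rprop_gt0. Qed.

(** Puts the flow from x to y into the form of a minimum of two products, symmetric in x and y:
    detailed balance. *)
Lemma mul_min1_ratio (a b c : R) : 0 < a -> 0 < b ->
  a * (Num.min 1 (c / (a * b)) * b) = Num.min (a * b) c.
Proof.
move=> a0 b0; have ab0 : 0 < a * b by rewrite mulr_gt0.
by rewrite mulrCA mulrC minr_pMr ?(ltW ab0)// mulr1 (mulrC (a * b) (c / _)) divfK// gt_eqF.
Qed.

Lemma mala_reversible x y : pidens U x * k x y = pidens U y * k y x.
Proof.
have px z : 0 < pidens U z by rewrite pidensE mulr_gt0 ?expR_gt0// invr_gt0.
apply: etrans (mul_min1_ratio _ (px x) (rprop_gt0 U gam_gt0 x y)) _.
apply: etrans (minC _ _) (esym (mul_min1_ratio _ (px y) (rprop_gt0 U gam_gt0 y x))).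
Qed.

Lemma measurable_mala_density1 x : measurable_fun setT (k x).
Proof. exact: (measurableT_comp measurable_mala_density (pair1_measurable x)). Qed.

Lemma integrable_mala_density x : mu.-integrable setT (fun y => (k x y)%:E).
Proof.
apply: (le_integrable measurableT _ _ (integrable_rprop U gam_gt0 muE x)) => /=.
  by apply/measurable_EFinP; exact: measurable_mala_density1.
move=> y _; rewrite lee_fin !ger0_norm ?mala_density_ge0 ?mala_density_le//.
by rewrite ltW// rprop_gt0.
Qed.

Lemma integrable_Wmala_density x : mu.-integrable setT (fun y => (W y * k x y)%:E).
Proof.
apply: (le_integrable measurableT _ _ (integrable_Wrprop UC2 hessL gam_gt0 eta_gt0 muE x)) => /=.
  by apply/measurable_EFinP; apply: measurable_funM; [exact: measurable_Wfun|exact: measurable_mala_density1].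
move=> y _; have r0 := ltW (rprop_gt0 U gam_gt0 x y).
rewrite lee_fin (normrM (W y) (k x y)) (normrM (W y) (rprop U gam x y)) ler_wpM2l//.
rewrite (ger0_norm (mala_density_ge0 x y)) (ger0_norm r0).
exact: mala_density_le.
Qed.

Lemma mala_density_mass_le1 x : \int[mu]_y k x y <= 1.
Proof.
rewrite -(Rintegral_rprop U gam_gt0 muE x); apply: le_Rintegral => //.
- exact: integrable_mala_density.
- exact: integrable_rprop.
- by move=> y _; exact: mala_density_le.
Qed.

(** The proposal has mass 1, so the rejected mass is 1 minus the accepted one. *)
Lemma malaE f : Wbounded W f -> mala U gam f = metropolis_op mu k f.
Proof.
move=> Ff; apply/funext => x; rewrite /mala /metropolis_op.
have fk : mu.-integrable setT (fun y => (f y * accept U gam x y * rprop U gam x y)%:E).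
  under eq_fun do rewrite -mulrA.
  exact: integrable_weight (measurable_mala_density1 x) (mala_density_ge0 x)
    (integrable_Wmala_density x) _ Ff.
have rk := integrableB measurableT (integrable_rprop U gam_gt0 muE x) (integrable_mala_density x).
rewrite (RintE muE fk).
have -> : (fun y => (1 - accept U gam x y) * rprop U gam x y) = (fun y => rprop U gam x y - k x y).
  by apply/funext => y; rewrite mulrBl mul1r.
rewrite (RintE muE rk) RintegralB//; [|exact: integrable_rprop|exact: integrable_mala_density].
rewrite Rintegral_rprop//; congr (_ + _).
by apply: eq_Rintegral => y _; rewrite -mulrA.
Qed.

Lemma pi_intE f : Wbounded W f -> pi_int U f = \int[mu]_y (f y * pidens U y).
Proof.
move=> Ff; apply: RintE => //.
exact: integrable_weight measurable_pidens pidens_ge0 (integrable_Wpidens eta_gt0) _ Ff.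
Qed.

Lemma mala_density_box x m e : 0 <= e ->
  (forall y, vnorm (vadd y (vopp m)) <= d%:R -> e <= k x y) -> e * 2 ^+ d <= \int[mu]_y k x y.
Proof.
move=> e0 he.
rewrite -(Rintegral_box muE m) -RintegralZl//; last exact: integrable_box.
apply: le_Rintegral => //; [|exact: integrable_mala_density|].
- exact: (integrableZl measurableT e (integrable_box muE _)).
- by move=> y _; apply: (@box_le (k x)) => // ?; exact: mala_density_ge0.
Qed.

Let peak : R := (4 * pi * gam) `^ (- (d%:R / 2)).
Let peak_gt0 : 0 < peak. Proof. by rewrite powR_gt0// !mulr_gt0 ?pi_gt0. Qed.

Lemma mala_density_ge x y (c rho : R) : 0 <= c -> - c <= log_ratio U gam x y -> 
  vnorm (vadd y (vopp (proposal_mean U gam x))) <= rho ->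
  peak * expR (- c - rho ^+ 2 / (4 * gam)) <= k x y.
Proof.
move=> c0 hc hy.
have rho0 : 0 <= rho by apply: le_trans hy; exact: vnorm_ge0.
rewrite expRD mulrCA; apply: ler_pM; rewrite ?expR_ge0 ?mulr_ge0 ?expR_ge0 ?(ltW peak_gt0)//.
  by rewrite accept_log le_min ler_expR hc andbT -expR0 ler_expR oppr_le0.
rewrite /rprop proposal_shift ler_wpM2l ?(ltW peak_gt0)// ler_expR mulNr lerN2.
by rewrite ler_wpM2r ?invr_ge0 ?mulr_ge0 ?(ltW gam_gt0)// ler_sqr ?nnegrE ?vnorm_ge0.
Qed.

(** Far out, rejection keeps at most (1 - a) W x and the proposals add at most (a / 2) W x; on the
    remaining ball everything is bounded. *)
Lemma mala_drift : gam * (L + 1) <= 1 / 4 -> gam * (4 * (Lb + 1) ^+ 2 / mb) <= 1 / 4 ->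
  exists lambda b : R, [/\ 0 <= lambda < 1, 0 < b &
    forall x, metropolis_op mu k W x <= lambda * W x + b].
Proof.
move=> gamL gamC; have L0 := L_ge0; have gam0 := gam_gt0; have eta0 := eta_gt0.
have gamL1 : gam * L <= 1 / 4 by lra.
(* Noise of norm at most d covers the cube about the proposal mean. *)
have [K0 [c hc]] := log_ratio_far beta01 UC2 grad0 L_ge0 hessL mb_gt0 Lb_ge0 Kb_ge0 hessB
  gam_gt0 gamL1 gamC (ler0n R d).
pose c' := Num.max c 0.
pose e := peak * expR (- c' - d%:R ^+ 2 / (4 * gam)).
have e0 : 0 < e by rewrite mulr_gt0// expR_gt0.
pose a := Num.min 1 (e * 2 ^+ d).
have a0 : 0 < a by rewrite lt_min ltr01 mulr_gt0// exprn_gt0.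
have a1 : a <= 1 by rewrite ge_min lexx.
have mass x : K0 <= vnorm x -> a <= \int[mu]_y k x y.
  move=> xK; apply: (@le_trans _ _ (e * 2 ^+ d)); first by rewrite ge_min lexx orbT.
  apply: (@mala_density_box x (proposal_mean U gam x)); first exact: ltW.
  move=> y yd; apply: mala_density_ge => //; first by rewrite le_max lexx orbT.
  apply: (@le_trans _ _ (- c)); first by rewrite lerN2 le_max lexx.
  have := hc x _ xK yd.
  congr (_ <= log_ratio _ _ _ _).
  by apply: eq_from_tnth => i; rewrite !tnthE; ring.
pose M := exp_moment d gam eta.
have M0 : 0 < M by exact: exp_moment_gt0.
have opW x : metropolis_op mu k W x <=
    expR (eta * (1 + vnorm (proposal_mean U gam x))) * M + W x * (1 - \int[mu]_y k x y).
  rewrite lerD2r; apply: le_trans (Rintegral_Wrprop UC2 hessL gam_gt0 eta_gt0 muE x).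
  apply: le_Rintegral => //.
  - exact: integrable_Wmala_density.
  - exact: (integrable_Wrprop UC2 hessL gam_gt0 eta_gt0 muE x).
  - by move=> y _; rewrite ler_wpM2l ?mala_density_le// expR_ge0.
(* Chosen so that exp (eta (1 - D)) M = a / 2. *)
pose D := 1 + ln (2 * M / a) / eta.
have Ma : 0 < 2 * M / a by rewrite divr_gt0// mulr_gt0.
have DE : expR (eta * (1 - D)) * M = a / 2.
  have -> : eta * (1 - D) = - ln (2 * M / a).
    by rewrite /D; field; rewrite gt_eqF.
  rewrite expRN lnK ?posrE//; field.
  by rewrite !gt_eqF.
have gamL2 : gam * (L + 1) <= 1 by lra.
have [K1 K1_ge1 hK1] := drift_contract beta01 UC2 grad0 L_ge0 hessL mb_gt0 hessB D gam_gt0 gamL2.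
pose K := Num.max K0 K1.
(* The constant covers |x| <= K, where the proposal mean has norm at most 2 K. *)
exists (1 - a / 2), (expR (eta * (1 + (K + K))) * M + expR (eta * (1 + K))).
have b0 : 0 < expR (eta * (1 + (K + K))) * M + expR (eta * (1 + K)).
  by rewrite addr_gt0 ?mulr_gt0 ?expR_gt0.
split=> //; first by apply/andP; split; lra.
move=> x; have W0 : 0 <= W x by exact: expR_ge0.
have m0 : 0 <= \int[mu]_y k x y by apply: Rintegral_ge0 => y _; exact: mala_density_ge0.
have [xK|/ltW xK] := lerP K (vnorm x).
  move: xK; rewrite ge_max => /andP[xK0 xK1].
  apply: le_trans (opW x) _.
  have h1 : expR (eta * (1 + vnorm (proposal_mean U gam x))) * M <= a / 2 * W x.
    rewrite -DE mulrAC ler_pM2r//.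
    have /andP[h _] := Wfun_bounds eta_gt0 x.
    apply: le_trans (ler_wpM2l (expR_ge0 _) h).
    rewrite -expRD ler_expR -mulrDr ler_pM2l//; have := hK1 x xK1.
    rewrite -/(proposal_mean U gam x); lra.
  have h2 : W x * (1 - \int[mu]_y k x y) <= W x * (1 - a).
    by rewrite ler_wpM2l// lerD2l lerN2; exact: mass.
  lra.
apply: le_trans (opW x) _.
have pm : vnorm (proposal_mean U gam x) <= K + K.
  apply: le_trans (vnorm_vadd _ _) _; rewrite vnorm_vscale normrN gtr0_norm//.
  apply: lerD => //; apply: le_trans xK.
  apply: le_trans (ler_wpM2l (ltW gam_gt0) (grad_le UC2 L_ge0 grad0 hessL x)) _.
  by rewrite mulrA ler_piMl ?vnorm_ge0//; lra.
have h1 : expR (eta * (1 + vnorm (proposal_mean U gam x))) * M <= expR (eta * (1 + (K + K))) * M.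
  by rewrite ler_pM2r// ler_expR ler_pM2l// lerD2l.
have h2 : W x * (1 - \int[mu]_y k x y) <= expR (eta * (1 + K)).
  apply: (@le_trans _ _ (W x)); first by rewrite ler_piMr// gerBl.
  have /andP[_ h] := Wfun_bounds eta_gt0 x.
  by apply: le_trans h _; rewrite ler_expR ler_pM2l// lerD2l.
have : 0 <= (1 - a / 2) * W x by rewrite mulr_ge0//; lra.
lra.
Qed.

(** Integration against the uniform distribution on [-1, 1]^d, the minorizing measure. *)
Definition box_mean f : R := \int[mu]_y (f y * (2 ^- d * box (origin R d) y)).

Let w y : R := 2 ^- d * box (origin R d) y.
Let w_ge0 y : 0 <= w y. Proof. by rewrite mulr_ge0 ?box_ge0// invr_ge0 exprn_ge0. Qed.
Let mw : measurable_fun setT w.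
Proof. by apply: measurable_funM => //; exact: measurable_box. Qed.

Let vadd_N0 y : vadd y (vopp (origin R d)) = y.
Proof. by apply: eq_from_tnth => i; rewrite tnth_vadd tnth_vopp tnth_origin subr0. Qed.

Lemma box_mean_pos : positive_linear (Wbounded W) box_mean.
Proof.
apply: positive_linear_weight => //.
pose M := expR (eta * (1 + d%:R)).
apply: (le_integrable measurableT _ _ (integrableZl measurableT (M * 2 ^- d)
  (integrable_box muE (origin R d)))) => /=.
  by apply/measurable_EFinP; apply: measurable_funM => //; exact: measurable_Wfun.
move=> y _; rewrite lee_fin ger0_norm; last by rewrite mulr_ge0 ?w_ge0// expR_ge0.
apply: le_trans (ler_norm _); rewrite /w mulrA.
have [->|b0] := eqVneq (box (origin R d) y) 0; first by rewrite !mulr0.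
rewrite ler_wpM2r ?box_ge0// ler_wpM2r ?invr_ge0 ?exprn_ge0//.
have := box_neq0_near b0; rewrite vadd_N0 => yd.
have /andP[_ h] := Wfun_bounds eta_gt0 y; apply: le_trans h _.
by rewrite ler_expR ler_pM2l// lerD2l.
Qed.

Lemma box_mean1 : box_mean (fun=> 1) = 1.
Proof.
rewrite /box_mean; under eq_Rintegral do rewrite mul1r.
rewrite RintegralZl//; last exact: integrable_box.
by rewrite Rintegral_box// mulVf// expf_neq0.
Qed.

Lemma log_ratio_ge x y (r : R) : vnorm x <= r -> vnorm y <= r ->
  - (L * r ^+ 2 + L * r ^+ 2 + (r + r) * (L * r + L * r) / 2 + gam / 4 * (L * r) ^+ 2)
    <= log_ratio U gam x y.
Proof.
move=> xr yr; have r0 : 0 <= r by apply: le_trans xr; exact: vnorm_ge0.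
have sq z : vnorm z <= r -> L * vnorm z ^+ 2 <= L * r ^+ 2.
  by move=> zr; rewrite ler_wpM2l// ler_sqr ?nnegrE ?vnorm_ge0.
have gr z : vnorm z <= r -> vnorm (grad U z) <= L * r.
  by move=> zr; apply: le_trans (grad_le UC2 L_ge0 grad0 hessL z) _; rewrite ler_wpM2l.
have := potential_le UC2 L_ge0 grad0 hessL x; rewrite ler_norml => /andP[h1 _].
have := potential_le UC2 L_ge0 grad0 hessL y; rewrite ler_norml => /andP[_ h2].
have h3 : `|dot (vadd y (vopp x)) (vadd (grad U x) (grad U y))| <= (r + r) * (L * r + L * r).
  apply: le_trans (normr_dot_le _ _) _; apply: ler_pM; rewrite ?vnorm_ge0//.
    by apply: le_trans (vnorm_vadd _ _) _; rewrite vnorm_vopp lerD.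
  by apply: le_trans (vnorm_vadd _ _) _; rewrite lerD ?gr.
have := h3; rewrite ler_norml => /andP[h3' _].
have h4 : gam / 4 * dot (grad U y) (grad U y) <= gam / 4 * (L * r) ^+ 2.
  rewrite ler_wpM2l ?divr_ge0 ?(ltW gam_gt0)// -vnorm_sqr.
  by rewrite ler_sqr ?nnegrE ?vnorm_ge0 ?mulr_ge0// gr.
have h5 : 0 <= gam / 4 * dot (grad U x) (grad U x).
  by rewrite mulr_ge0 ?dot_ge0// divr_ge0// ltW.
have := sq x xr; have := sq y yr; rewrite /log_ratio; lra.
Qed.

Lemma mala_minor (r : R) : exists2 e : R, 0 < e & forall x f, W x <= r ->
  Wbounded W f -> (forall y, 0 <= f y) -> e * box_mean f <= metropolis_op mu k f x.
Proof.
(* As eta |x| <= exp (eta |x|) <= W x, the ball of radius rho contains the sublevel set of W; it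
   also contains the cube. *)
pose rho := Num.max (r / eta) d%:R.
have rho0 : 0 <= rho by rewrite le_max ler0n orbT.
pose c := L * rho ^+ 2 + L * rho ^+ 2 + (rho + rho) * (L * rho + L * rho) / 2 + gam / 4 * (L * rho) ^+ 2.
have c0 : 0 <= c.
  have g4 : 0 <= gam / 4 by rewrite divr_ge0// ltW.
  have := mulr_ge0 L_ge0 (sqr_ge0 rho); have := mulr_ge0 g4 (sqr_ge0 (L * rho)).
  rewrite /c; lra.
pose q := rho + (rho + gam * (L * rho)).
pose e0 := peak * expR (- c - q ^+ 2 / (4 * gam)).
have e0_gt0 : 0 < e0 by rewrite mulr_gt0// expR_gt0.
have twod : 0 < 2 ^+ d :> R by rewrite exprn_gt0.
exists (e0 * 2 ^+ d); first by rewrite mulr_gt0.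
move=> x f Wr Ff f0.
have xr : vnorm x <= rho.
  rewrite le_max; apply/orP; left; rewrite ler_pdivlMr// mulrC; apply: le_trans Wr.
  have /andP[h _] := Wfun_bounds eta_gt0 x; apply: le_trans h.
  by apply: le_trans (expR_ge1Dx _); rewrite lerDr.
have kw y : e0 * box (origin R d) y <= k x y.
  apply: (@box_le (k x)); [exact: ltW|by move=> ?; exact: mala_density_ge0|move=> {}y].
  rewrite vadd_N0 => yd.
  have yr : vnorm y <= rho by rewrite le_max yd orbT.
  apply: mala_density_ge => //; first exact: log_ratio_ge.
  apply: le_trans (vnorm_vadd _ _) _; rewrite vnorm_vopp lerD//.
  apply: le_trans (vnorm_vadd _ _) _; rewrite lerD//.
  rewrite vnorm_vscale normrN gtr0_norm// ler_pM2l//.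
  by apply: le_trans (grad_le UC2 L_ge0 grad0 hessL x) _; rewrite ler_wpM2l.
(* The rejection part is nonnegative and is dropped. *)
apply: (@le_trans _ _ (\int[mu]_y (f y * k x y))); last first.
  by rewrite lerDl mulr_ge0// subr_ge0 mala_density_mass_le1.
have Ww : mu.-integrable setT (fun y => (f y * w y)%:E).
  apply: (le_integrable measurableT _ _ (integrableZl measurableT (2 ^- d * e0^-1)
    (integrable_weight (measurable_mala_density1 x) (mala_density_ge0 x)
    (integrable_Wmala_density x) Ff))) => /=.
    by apply/measurable_EFinP; apply: measurable_funM => //; exact: Ff.1.
  move=> y _; rewrite lee_fin (ger0_norm (mulr_ge0 (f0 y) (w_ge0 y))).
  apply: le_trans (ler_norm _).
  rewrite (_ : _ * (f y * k x y) = f y * (2 ^- d * (e0^-1 * k x y))); last by ring.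
  rewrite ler_wpM2l// /w ler_wpM2l ?invr_ge0 ?(ltW twod)//.
  by rewrite ler_pdivlMl.
have -> : e0 * 2 ^+ d * box_mean f = \int[mu]_y (e0 * 2 ^+ d * (f y * w y)).
  by rewrite RintegralZl.
apply: le_Rintegral => //.
- exact: (integrableZl measurableT _ Ww).
- exact: integrable_weight (measurable_mala_density1 x) (mala_density_ge0 x)
    (integrable_Wmala_density x) _ Ff.
- move=> y _; rewrite (_ : _ * (f y * w y) = f y * (e0 * box (origin R d) y)).
    by rewrite ler_wpM2l.
  by rewrite /w; field; rewrite gt_eqF.
Qed.

Theorem mala_geometric : gam * (L + 1) <= 1 / 4 -> gam * (4 * (Lb + 1) ^+ 2 / mb) <= 1 / 4 ->
  exists C rho : R, 0 <= C /\ 0 <= rho < 1 /\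
    forall x n, VnormLe W (fun f => iter n (mala U gam) f x - pi_int U f) (C * rho ^+ n * W x).
Proof.
move=> gamL gamC; have [lambda [b [lambda01 b0 drift]]] := mala_drift gamL gamC.
have W1 : forall x, 1 <= W x by move=> x; exact: Wfun_ge1.
have [C [rho [C0 [rho01 H]]]] := metropolis_geometric measurable_mala_density mala_density_ge0
  measurable_pidens pidens_ge0 mala_reversible (@measurable_Wfun R d eta) W1
  integrable_Wmala_density (integrable_Wpidens eta_gt0) mala_density_mass_le1
  Rintegral_pidens lambda01 b0 drift box_mean_pos box_mean1 mala_minor.
exists C, rho; split=> //; split=> // x n f mf fW.
have Ff : Wbounded W f by split=> //; exists 1 => y; rewrite mul1r.
rewrite pi_intE//.
suff -> : iter n (mala U gam) f = iter n (metropolis_op mu k) f by exact: H.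
have Fit j : Wbounded W (iter j (metropolis_op mu k) f).
  elim: j => //= j; apply: (Wbounded_metropolis measurable_mala_density mala_density_ge0
    (@measurable_Wfun R d eta) W1 integrable_Wmala_density mala_density_mass_le1 b0 drift).
by elim: n => //= n ->; exact: malaE.
Qed.

End step.
End mala_kernel.

Theorem theorem4 (R : realType) (d : nat) (U : d.-tuple R -> R)
    (beta L mb Lb Kb : R) :
  0 <= beta < 1 ->
  C2 U ->
  (forall i, partial U i (origin R d) = 0) ->
  0 <= L ->
  (forall x y z, `|hess U x y z| <= L * vnorm y * vnorm z) ->
  0 < mb -> 0 <= Lb -> 0 <= Kb ->
  (forall x y, Kb <= vnorm x -> vnorm y = 1 ->
     hess U x y y <= Lb / (1 + vnorm x `^ (3 * beta / 4)) /\
     mb / (1 + vnorm x `^ beta) <= hess U x y y) ->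
  exists Gam : R, 0 < Gam /\
    forall gam : R, 0 < gam <= Gam ->
      exists C rho : R, 0 <= C /\ 0 <= rho < 1 /\
        forall (x : d.-tuple R) (k : nat),
          VnormLe (Wfun (mb / 2 ^+ 5))
            (fun f => iter k (mala U gam) f x - pi_int U f)
            (C * rho ^+ k * Wfun (mb / 2 ^+ 5) x).
Proof.
move=> beta01 UC2 grad0 L0 hessL mb0 Lb0 Kb0 hessB.
have [mu muE] := tint_measure R d.
pose C0 := 4 * (Lb + 1) ^+ 2 / mb.
have C00 : 0 < C0 by rewrite divr_gt0// mulr_gt0// exprn_gt0//; lra.
have L1 : 0 < L + 1 by lra.
(* The first bound keeps proposals with bounded noise within |x| / 2 of a far point x and makes the
   drift step contract; the second lets the gain m / 4 pay for the term with gam M^2 / 2. *)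
exists (Num.min (1 / 4 / (L + 1)) (1 / 4 / C0)).
have q0 : 0 < 1 / 4 :> R by lra.
split; first by rewrite lt_min; apply/andP; split; exact: divr_gt0.
move=> gam /andP[gam0]; rewrite le_min (ler_pdivlMr _ _ L1) (ler_pdivlMr _ _ C00) => /andP[gamL gamC].
have eta0 : 0 < mb / 2 ^+ 5 by rewrite divr_gt0// exprn_gt0.
exact: (mala_geometric beta01 UC2 grad0 L0 hessL mb0 Lb0 Kb0 hessB muE gam0 eta0 gamL gamC).
Qed.
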